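(* Let $T>0$ and let $\Phi=(\Phi_t)$ be a non-anticipating process for which the Itô integral $\int_0^T\Phi_t\,dB_t$ exists. For each $n$ let $\triangle_n$ be the equal partition $t_j=jT/n$, $j=0,\dots,n$, of $[0,T]$, let $J=\{0,\dots,n-1\}$, and let $J_{K(n)}\subset J$ be any subset with exactly $K(n)$ elements, where $K(n)$ is a positive integer with $0<K(n)<n$ and $\lim_{n\to+\infty}K(n)/n=0$. Then $$\mathop{\mathrm{l.i.m.}}_{\|\triangle_n\|\to0}\ \sum_{j\in J\setminus J_{K(n)}}\Phi_{t_j}(B_{t_{j+1}}-B_{t_j})=\int_0^T\Phi_t\,dB_t .$$
   Context: $(\Omega,\mathcal F,(\mathcal F_t),P)$ is a probability space with a complete right-continuous filtration generated by a one-dimensional standard Brownian motion $B=(B_t)$, each $\mathcal F_t$ containing all $P$-null sets. $\mathrm{l.i.m.}$ denotes limit in mean square, i.e. in $L^2(\Omega,P)$. For a partition $\triangle_n:0=t_0<\cdots<t_n=T$, $\|\triangle_n\|=\max_{0\le i\le n-1}(t_{i+1}-t_i)$; for the equal partition $\|\triangle_n\|=T/n$, so $\|\triangle_n\|\to0$ means $n\to\infty$. $\Phi_t$ denotes the value of the process at time $t$ (also written $\Phi(B_t,t)$). The Itô stochastic integral of a non-anticipating (adapted) process is $\int_0^T\Phi_t\,dB_t=\mathop{\mathrm{l.i.m.}}_{\|\triangle_n\|\to0}\sum_{i=0}^{n-1}\Phi_{t_i}(B_{t_{i+1}}-B_{t_i})$, the limit being over arbitrary partitions of $[0,T]$; it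 exists if this limit exists. *)

(* Defs.v *)
From mathcomp Require Import all_boot all_order all_algebra.
From mathcomp Require Import all_classical all_reals all_analysis.

Set Implicit Arguments.
Unset Strict Implicit.
Unset Printing Implicit Defensive.
Import Order.TTheory GRing.Theory Num.Theory.
Import numFieldNormedType.Exports.
Local Open Scope classical_set_scope.
Local Open Scope ring_scope.

Section mean_square.
Context d (Omega : measurableType d) (R : realType) (P : probability Omega R).

(* Y = l.i.m. of X along F.  The convergence takes place in L^2(Omega, P), so
   the limit and eventually all the X i are required to be square-integrable. *)
Definition is_lim_ms (I : Type) (F : set_system I)
    (X : I -> Omega -> R) (Y : Omega -> R) : Prop :=
  [/\ Y \in Lfun P 2%:E,
      \forall i \near F, X i \in Lfun P 2%:E &
      ('E_P[fun w => ((X i w - Y w) ^+ 2)%R])%E @[i --> F] --> 0%E].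

End mean_square.

Section brownian.
Context d (Omega : measurableType d) (R : realType) (P : probability Omega R).

(* Some of the A i may be setT, so that the product rule for subfamilies is
   included. *)
Definition mutually_independent (I : finType) (X : I -> Omega -> R) : Prop :=
  forall A : I -> set R, (forall i, measurable (A i)) ->
    P (\bigcap_(i in [set: I]) (X i @^-1` A i)) =
    (\prod_i P (X i @^-1` A i))%E.

(* Only the restriction of B to [0, +oo[ is relevant.  The second parameter of
   normal_prob is the standard deviation.  The laws are compared on Borel sets
   only, because both sides are total set functions. *)
Record is_brownian_motion (B : R -> {RV P >-> R}) : Prop := {
  brownian_start : {ae P, forall w, B 0 w = 0} ;
  brownian_indep : forall (n : nat) (t : nat -> R), 0 <= t 0%N ->
    (forall i, (i < n)%N -> t i < t i.+1) ->
    mutually_independent (fun (i : 'I_n) w => B (t i.+1) w - B (t i) w) ;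
  brownian_gauss : forall s t : R, 0 <= s -> s < t ->
    forall A : set R, measurable A ->
    pushforward P (fun w => B t w - B s w) A =
    normal_prob 0 (Num.sqrt (t - s)) A ;
  brownian_continuous :
    {ae P, forall w, {within `[0, +oo[, continuous (fun t : R => B t w : R)}} }.

Definition null_sets : set_system Omega := [set N | measurable N /\ P N = 0%E].

(* The complete right-continuous filtration generated by B: the intersection
   over s > t of the sigma-algebras generated by the null sets and by the B u,
   0 <= u <= s.  No completeness of P is needed here; if P is complete, then
   null_sets consists of all P-negligible sets. *)
Definition brownian_filtration (B : R -> {RV P >-> R}) (t : R) :
    set_system Omega :=
  \bigcap_(s in `]t, +oo[)
    <<s null_sets `|`
        \bigcup_(u in `[0, s]) preimage_set_system setT (B u) measurable >>.

Definition non_anticipating (B : R -> {RV P >-> R}) (T : R)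
    (Phi : R -> Omega -> R) : Prop :=
  forall t : R, 0 <= t <= T -> forall A : set R, measurable A ->
    brownian_filtration B t (Phi t @^-1` A).

End brownian.

Section ito.
Context d (Omega : measurableType d) (R : realType) (P : probability Omega R).

(* A partition 0 = t_0 < ... < t_n = T is encoded as in itv_partition 0 T by
   the list s = [:: t_1; ...; t_n] of its points other than 0. *)
Definition partition_point (s : seq R) (i : nat) : R := nth 0 (0 :: s) i.

Definition mesh (s : seq R) : R :=
  \big[Num.max/0]_(i < size s) (partition_point s i.+1 - partition_point s i).

(* The filter "the mesh of the partition tends to 0" on partitions of [0, T]. *)
Definition mesh_to0 (T : R) : set_system (seq R) :=
  filter_from [set e : R | 0 < e]
    (fun e => [set s | itv_partition 0 T s /\ mesh s < e]).

Definition ito_sum (B : R -> {RV P >-> R}) (Phi : R -> Omega -> R)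
    (s : seq R) (w : Omega) : R :=
  \sum_(i < size s) Phi (partition_point s i) w *
    (B (partition_point s i.+1) w - B (partition_point s i) w).

Definition is_ito_integral (B : R -> {RV P >-> R}) (Phi : R -> Omega -> R)
    (T : R) (I : Omega -> R) : Prop :=
  is_lim_ms P (mesh_to0 T) (ito_sum B Phi) I.

End ito.

(* Main.v *)
Require Import Defs.
From HB Require Import structures.
From mathcomp Require Import all_boot all_order all_algebra.
From mathcomp Require Import all_classical all_reals all_analysis.
From mathcomp Require Import measurable_realfun ring lra.
Set Implicit Arguments.
Unset Strict Implicit.
Unset Printing Implicit Defensive.
Import Order.TTheory GRing.Theory Num.Theory.
Import numFieldNormedType.Exports.
Local Open Scope classical_set_scope.
Local Open Scope ring_scope.

(* Any sum of F_(t_i)-measurable weights Psi_i times increments satisfies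
   E (sum Psi_i (B_(t_i+1) - B_(t_i)))^2 =
     sum E (B_(t_i+1) - B_(t_i))^2 * E Psi_i^2  in [0, +oo],
   without any integrability assumption on Psi.  Hence deleting terms decreases
   the second moment of such a sum.

   Let U_n be the full equal-partition sums and V_n the sum over J_K(n).  Writing
   U_n and a fixed U_m on the common refinement with nm cells, V_n is the sum, over
   the fine cells inside the cells of J_K(n), of the difference of the two
   integrands plus the integrand of U_m.  The first part is at most
   E (U_n - U_m)^2, which is small because (U_n) is Cauchy; the second is at most
   a constant depending on m times K(n) / n. *)

(** The deleted terms cannot be estimated one by one: the second moments of [Phi] at the grid times
    may grow without bound as the partition is refined, and nothing is assumed about their
    finiteness. Comparison with a fixed [U_m] leaves only the finitely many integrands of [U_m].
    Their second moments are finite because the identity holds in [0, +oo], its left side is finite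
    for suitable m, and the increments have positive second moment.

    The identity must therefore be proved where cross terms need not be integrable. For this reason
    centring is expressed by nonnegative functions only: for the increment X over a cell starting at
    t and A in F_t, E[X^2 1_A] = c P(A) and E[(X + 1)^2 1_A] = (c + 1) P(A), whose difference says
    that X has conditional mean 0.

    A second obstacle is that F_t is an intersection over s > t, hence possibly larger than the past
    up to t. Independence is directly available only for increments that start at some s > t, and a
    limit s -> t transfers the two moment formulas to F_t. *)

Section density.
Context d1 d2 (X : measurableType d1) (Y : measurableType d2) (R : realType).
Variables (phi : X -> Y) (mphi : measurable_fun setT phi).
Variables (mu : {measure set X -> \bar R}) (nu : {measure set Y -> \bar R}).
Variables (p : X -> R) (mp : measurable_fun setT p) (p0 : forall x, 0 <= p x).
Hypothesis nuE : forall A, measurable A ->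
  nu A = (\int[mu]_(x in phi @^-1` A) (p x)%:E)%E.

Import HBNNSimple.

(** Here [nu] is the image under [phi] of the measure with density [p]. The single form covers
    changes of density ([phi] the identity), laws of random variables ([p] = 1) and laws restricted
    to an event ([p] an indicator). It is checked on simple functions and extended by monotone
    convergence. *)
Lemma ge0_integral_density (f : Y -> R) :
  measurable_fun setT f -> (forall y, 0 <= f y) ->
  (\int[nu]_y (f y)%:E = \int[mu]_x (f (phi x) * p x)%:E)%E.
Proof.
move=> mf f0.
have mfE : measurable_fun setT (EFin \o f) by exact/measurable_EFinP.
have f0E y : (0 <= (EFin \o f) y)%E by rewrite lee_fin.
pose f_ := nnsfun_approx measurableT mfE.
have cvgf y : (f_ n y)%:E @[n --> \oo] --> (f y)%:E.
  by apply: (@cvg_nnsfun_approx _ _ _ _ measurableT _ mfE) => // x _; exact: f0E.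
have ndf y : {homo f_^~ y : m n / (m <= n)%N >-> m <= n}.
  by move=> m n mn; exact/lefP/nd_nnsfun_approx.
have mfphi n : measurable_fun setT (fun x => f_ n (phi x)).
  exact: measurableT_comp.
transitivity (limn (fun n => \int[nu]_y (f_ n y)%:E))%E.
  rewrite -monotone_convergence//.
  - by apply: eq_integral => y _; apply/esym/cvg_lim => //; exact: cvgf.
  - by move=> n; exact/measurable_EFinP/measurable_funP.
  - by move=> n y _; rewrite lee_fin.
  - by move=> y _ m n mn; rewrite lee_fin; exact: ndf.
transitivity (limn (fun n => \int[mu]_x (f_ n (phi x) * p x)%:E))%E; last first.
  rewrite -monotone_convergence//.
  - apply: eq_integral => x _; apply/cvg_lim => //.
    have ff : f_ n (phi x) @[n --> \oo] --> f (phi x).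
      by have /fine_cvgP[_] := cvgf (phi x).
    by apply: cvg_EFin; [exact: nearW|exact: cvgM ff (cvg_cst _)].
  - by move=> n; apply/measurable_EFinP; exact: measurable_funM.
  - by move=> n x _; rewrite lee_fin mulr_ge0.
  - by move=> x _ m n mn; rewrite lee_fin ler_wpM2r//; exact: ndf.
congr (limn _); apply/funext => n.
have mpre r : measurable (phi @^-1` (f_ n @^-1` [set r])).
  by rewrite -(setTI (_ @^-1` _)); exact: mphi.
rewrite integralT_nnsfun sintegralE.
transitivity (\sum_(k \in range (f_ n))
    \int[mu]_x (k * (p x * \1_(phi @^-1` (f_ n @^-1` [set k])) x))%:E)%E.
  apply: eq_fsbigr => r; rewrite inE => -[y _ ry].
  have r0 : 0 <= r by rewrite -ry.
  under eq_integral do rewrite EFinM.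
  rewrite ge0_integralZl//=; last 2 first.
  - apply/measurable_EFinP; apply: measurable_funM => //.
  - by move=> x _; rewrite lee_fin mulr_ge0.
  congr (_ * _)%E; rewrite nuE// integral_mkcond.
  apply: eq_integral => x _; rewrite patchE indicE.
  by case: ifPn => _; rewrite ?mulr1 ?mulr0.
rewrite -ge0_integral_fsum//.
- apply: eq_integral => x _; rewrite fsumEFin//; congr EFin.
  rewrite [in RHS]fimfunE mulrC; rewrite fsbig_distrr//=.
  rewrite !fsbig_finite//=. 
  by apply: eq_bigr => r _; rewrite indicE/= mulrCA.
- move=> r; apply/measurable_EFinP; apply: measurable_funM => //.
  by apply: measurable_funM.
- move=> r x _; rewrite lee_fin; have [r0|r0] := leP 0 r.
    by rewrite !mulr_ge0.
  by rewrite preimage_nnfun0// preimage_set0 indic0/= !mulr0.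
Qed.

End density.

(** * Second moments of the centred normal law *)

Section normal_moments.
Context (R : realType).
Local Notation mu := (@lebesgue_measure R).
Local Open Scope ereal_scope.

(** Splitting at 0 turns either side into the sum of the same two integrals over the half-line, in
    opposite order. *)
Lemma ge0_integral_oppr (f : R -> R) : (forall x, (0 <= f x)%R) ->
  continuous f -> \int[mu]_x (f x)%:E = \int[mu]_x (f (- x)%R)%:E.
Proof.
move=> f0 cf.
have split_int (g : R -> R) : (forall x, (0 <= g x)%R) -> continuous g ->
    \int[mu]_x (g x)%:E = \int[mu]_(x in `[0%R, +oo[) (g x)%:E +
                          \int[mu]_(x in `[0%R, +oo[) (g (- x)%R)%:E.
  move=> g0 cg.
  have mg : measurable_fun [set: R] g by exact: continuous_measurable_fun.
  rewrite -(setUv `[0%R, +oo[%classic) ge0_integral_setU//= ; last 4 first.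
  - exact: measurableC.
  - by apply/measurable_EFinP; rewrite setUv.
  - by move=> x _; rewrite lee_fin.
  - exact/disj_setPCl.
  congr +%E; rewrite setCitvr.
  rewrite integral_itv_bndo_bndc; last exact/measurable_EFinP/measurable_funTS.
  rewrite -{1}oppr0 ge0_integration_by_substitutionNy//.
  exact: continuous_subspaceT.
rewrite !split_int// 1?addeC.
- by congr +%E; apply: eq_integral => x _; rewrite opprK.
- by move=> x; apply: continuous_comp; [exact: opp_continuous|exact: cf].
Qed.

Variables (s : R) (s0 : (0 < s)%R).

Lemma integral_normal_prob (f : R -> R) :
  measurable_fun setT f -> (forall y, (0 <= f y)%R) ->
  \int[normal_prob 0 s]_y (f y)%:E = \int[mu]_x (f x * normal_pdf 0 s x)%:E.
Proof.
move=> mf f0; apply: (@ge0_integral_density _ _ _ _ _ id) => //.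
- exact: measurable_normal_pdf.
- by move=> x; exact: normal_pdf_ge0.
Qed.

(** The integrand is dominated pointwise by [8 * s ^+ 2] times the density of N(0, 2 s^2), which has
    integral 1. In 8 = 4 * 2, the 4 comes from x^2 = 4 s^2 u and the 2 bounds the ratio sqrt 2 of
    the two peaks. *)
Lemma normal_second_moment_le :
  \int[normal_prob 0 s]_x (x ^+ 2)%:E <= (8 * s ^+ 2)%:E.
Proof.
rewrite integral_normal_prob//; last by move=> y; exact: sqr_ge0.
pose s' := (Num.sqrt 2 * s)%R.
have s'0 : (0 < s')%R by rewrite mulr_gt0// sqrtr_gt0.
have s'2 : (s' ^+ 2 = 2 * s ^+ 2)%R by rewrite exprMn sqr_sqrtr.
have -> : (8 * s ^+ 2)%:E = \int[mu]_x ((8 * s ^+ 2)%:E * (normal_pdf 0 s' x)%:E).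
  rewrite integralZl//; last exact: integrable_normal_pdf.
  by rewrite integral_normal_pdf mule1.
apply: ge0_le_integral => //.
- by move=> x _; rewrite lee_fin mulr_ge0 ?sqr_ge0 ?normal_pdf_ge0.
- by apply/measurable_EFinP; apply: measurable_funM => //; exact: measurable_normal_pdf.
- by apply/measurable_EFinP; apply: measurable_funM => //; exact: measurable_normal_pdf.
move=> x _; rewrite -EFinM lee_fin !normal_pdfE ?gt_eqF//.
rewrite /normal_fun subr0 s'2.
(* u exp (- 2 u) <= exp (- u), and exp (- u) is the N(0, 2 s^2) density up to
   its constant. *)
set u := (x ^+ 2 / (4 * s ^+ 2))%R.
have sn0 : (s != 0)%R by rewrite gt_eqF.
have -> : (- x ^+ 2 / (s ^+ 2 *+ 2) = - u + - u)%R by rewrite /u; field.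
have -> : (- x ^+ 2 / (2 * s ^+ 2 *+ 2) = - u)%R by rewrite /u; field.
have -> : (x ^+ 2 = u * (4 * s ^+ 2))%R by rewrite /u; field.
have ue : (u * expR (- u) <= 1)%R.
  rewrite expRN -ler_pdivlMr ?invr_gt0 ?expR_gt0// invrK mul1r.
  by apply: le_trans (expR_ge1Dx u); rewrite lerDr.
have peak : (normal_peak s <= 2 * normal_peak s')%R.
  rewrite /normal_peak s'2 -mulrA -[in X in (_ <= 2 * X)%R]mulrnAr (sqrtrM (s ^+ 2 * pi *+ 2))//.
  set q := Num.sqrt (s ^+ 2 * _ *+ 2).
  have q0 : (0 < q)%R.
    by rewrite sqrtr_gt0 mulrn_wgt0// mulr_gt0 ?exprn_gt0 ?pi_gt0.
  have r2 : (Num.sqrt 2 <= 2 :> R)%R.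
    by rewrite -[leRHS]ger0_norm// -sqrtr_sqr ler_wsqrtr// expr2; lra.
  rewrite invfM mulrA ler_peMl ?invr_ge0 ?(ltW q0)//.
  by rewrite ler_pdivlMr ?mul1r// sqrtr_gt0.
rewrite expRD.
have -> : (u * (4 * s ^+ 2) * (normal_peak s * (expR (- u) * expR (- u))) =
  (4 * s ^+ 2) * (normal_peak s * (u * expR (- u))) * expR (- u))%R by ring.
have -> : (8 * s ^+ 2 * (normal_peak s' * expR (- u)) =
  (4 * s ^+ 2) * (2 * normal_peak s') * expR (- u))%R by ring.
rewrite ler_wpM2r ?expR_ge0// ler_wpM2l ?mulr_ge0 ?(ltW s0)//.
by rewrite (le_trans _ peak)// ler_piMr// normal_peak_ge0.
Qed.

(** Otherwise x^2 = 0 almost surely and the law is concentrated at 0, a Lebesgue-null point, hence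
    null for the normal law as well. *)
Lemma normal_second_moment_gt0 : 0 < \int[normal_prob 0 s]_x (x ^+ 2)%:E.
Proof.
rewrite lt_neqAle integral_ge0 ?andbT; last by move=> x _; rewrite lee_fin sqr_ge0.
apply/negP => /eqP/esym i0.
have m2 : measurable_fun [set: R] (fun x : R => (x ^+ 2)%:E).
  by apply/measurable_EFinP.
have : ae_eq (normal_prob 0 s) setT (fun x : R => (x ^+ 2)%:E) (cst 0).
  apply/ae_eq_integral_abs => //; rewrite -[RHS]i0.
  by apply: eq_integral => x _; rewrite gee0_abs// lee_fin sqr_ge0.
move=> [N [mN N0 subN]].
have N1 : normal_prob 0 s (~` [set 0%R]) = 0.
  apply: (subset_measure0 (mu := normal_prob 0 s)) N0 => //.
  - exact: measurableC.
  - move=> x /= x0; apply: subN => /= /(_ Logic.I)/eqP.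
    by rewrite eqe sqrf_eq0 => /eqP.
have N0' : normal_prob 0 s [set 0%R] = 0.
  apply: (null_content_dominatesP _ _).1 (normal_prob_dominates 0 s) _ _ _ => //.
  exact: lebesgue_measure_set1.
have := @probability_setT _ _ _ (normal_prob 0 s).
rewrite -(setvU [set 0%R]) measureU ?setICl//; last exact: measurableC.
by move=> /eqP; rewrite [X in X + _]N1 [X in _ + X]N0' adde0 eq_sym onee_eq0.
Qed.

(** Encodes that the mean is 0 without integrating a signed function. By symmetry of the density, (x
    + 1)^2 and (x - 1)^2 have the same integral, and their sum is 2 x^2 + 2. *)
Lemma normal_moment_add1 : \int[normal_prob 0 s]_x ((x + 1) ^+ 2)%:E =
   \int[normal_prob 0 s]_x (x ^+ 2)%:E + 1.
Proof.
have msqr : measurable_fun [set: R] (fun x : R => (x ^+ 2)%R) by [].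
have msqr1 : measurable_fun [set: R] (fun x : R => ((x + 1) ^+ 2)%R).
  by apply: measurable_funX; exact: measurable_funD.
have Mfin : \int[normal_prob 0 s]_x (x ^+ 2)%:E \is a fin_num.
  rewrite ge0_fin_numE; last by apply: integral_ge0 => x _; rewrite lee_fin sqr_ge0.
  exact: le_lt_trans normal_second_moment_le (ltry _).
set M := (X in X \is a fin_num) in Mfin *; set A := LHS.
have p0 x : (0 <= normal_pdf 0 s x)%R by exact: normal_pdf_ge0.
have cp := @continuous_normal_pdf R 0 s (lt0r_neq0 s0).
have mp := @measurable_normal_pdf R 0 s.
have c2 : continuous (fun x : R => (x + 1) ^+ 2)%R.
  move=> x; have := @continuous_comp R R R (+%R^~ 1%R) (fun y => y ^+ 2)%R x.
  apply; last exact: exprn_continuous.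
  by apply: cvgD; [exact: cvg_id|exact: cvg_cst].
have AE : A = \int[mu]_x ((x + 1) ^+ 2 * normal_pdf 0 s x)%:E.
  by rewrite -integral_normal_prob// => x; exact: sqr_ge0.
have AE' : A = \int[mu]_x ((x - 1) ^+ 2 * normal_pdf 0 s x)%:E.
  rewrite AE ge0_integral_oppr//.
  - apply: eq_integral => x _; rewrite !normal_pdfE ?gt_eqF//.
    by rewrite (_ : (- x + 1) ^+ 2 = (x - 1) ^+ 2)%R; [rewrite /normal_fun !subr0 sqrrN|ring].
  - by move=> x; rewrite mulr_ge0 ?sqr_ge0.
  - by move=> x; apply: cvgM; [exact: c2|exact: cp].
have : A + A = M + M + 1 + 1.
  rewrite {1}AE AE' -ge0_integralD//=; last 4 first.
  - by move=> x _; rewrite lee_fin mulr_ge0 ?sqr_ge0.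
  - by apply/measurable_EFinP; apply: measurable_funM.
  - by move=> x _; rewrite lee_fin mulr_ge0 ?sqr_ge0.
  - apply/measurable_EFinP; apply: measurable_funM => //.
    by apply: measurable_funX; exact: measurable_funD.
  transitivity (\int[mu]_x (2%:E * (x ^+ 2 * normal_pdf 0 s x)%:E +
                            2%:E * (normal_pdf 0 s x)%:E)).
    by apply: eq_integral => x _; rewrite -!EFinM -!EFinD; congr EFin; ring.
  rewrite ge0_integralD//=; last 4 first.
  - by move=> x _; rewrite -EFinM lee_fin mulr_ge0// mulr_ge0// sqr_ge0.
  - by apply: measurable_funeM; apply/measurable_EFinP; apply: measurable_funM.
  - by move=> x _; rewrite -EFinM lee_fin mulr_ge0.
  - by apply: measurable_funeM; apply/measurable_EFinP.
  rewrite !ge0_integralZl//=; last 4 first.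
  - by apply/measurable_EFinP.
  - by move=> x _; rewrite lee_fin.
  - by apply/measurable_EFinP; apply: measurable_funM.
  - by move=> x _; rewrite lee_fin mulr_ge0 ?sqr_ge0.
  rewrite -integral_normal_prob//; last by move=> x; exact: sqr_ge0.
  by rewrite integral_normal_pdf mule1 mule_natl mule2n -[RHS]addeA.
rewrite -(fineK Mfin) -!EFinD; case: A {AE AE'} => //= a [aE].
by rewrite -/M -(fineK Mfin) -EFinD; congr EFin; lra.
Qed.

End normal_moments.

(** * Independence of an event from a generated sigma-algebra *)

Section independence.
Context d (T : measurableType d) (R : realType) (P : probability T R).
Local Open Scope ereal_scope.

Lemma eq_prob_off_null (N A A' : set T) : measurable N -> measurable A ->
  measurable A' -> P N = 0 -> A `\` N = A' `\` N -> P A = P A'.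
Proof.
move=> mN mA mA' N0 AA'.
have AN (D : set T) : measurable D -> P D = P (D `\` N).
  move=> mD; rewrite (measureDI P mD mN) [X in _ + X](_ : _ = 0) ?adde0//.
  by apply: (subset_measure0 (mu := P)) N0; [exact: measurableI| |exact: subIsetr].
by rewrite AN// AA' -AN.
Qed.

(** As functions of [A], both sides are finite measures; they agree on a pi-system containing the
    whole space, hence on what it generates. *)
Lemma independent_sigma_algebra (G : set_system T) (E : set T) :
  measurable E -> G `<=` measurable -> setI_closed G -> G setT ->
  (forall A, G A -> P (A `&` E) = P A * P E) ->
  forall A, <<s G >> A -> P (A `&` E) = P A * P E.
Proof.
move=> mE Gm GI GT GE A GA.
have PEfin : P E \is a fin_num by exact: fin_num_measure.
have PE0 : (0 <= fine (P E))%R by exact: fine_ge0.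
have scaleE D : mscale (NngNum PE0) P D = P D * P E by rewrite /mscale/= fineK// muleC.
rewrite -scaleE.
apply: (@g_sigma_algebra_measure_unique _ R T G Gm (fun _ => setT) (fun _ => GT) _
  (mrestr P mE) (mscale (NngNum PE0) P) GI) GA.
- by rewrite -subTset => x _; exists 0%N.
- by move=> D GD; exact: etrans (GE D GD) (esym (scaleE D)).
- by move=> _; rewrite (le_lt_trans (probability_le1 _ _)) ?ltry//; exact: measurableI.
Qed.

End independence.

(** * Independence of a Brownian increment from the past *)

Section brownian_past.
Context d (T : measurableType d) (R : realType) (P : probability T R).
Variables (B : R -> {RV P >-> R}) (hB : is_brownian_motion B).
Local Open Scope ereal_scope.

Definition increment (s t : R) (w : T) : R := (B t w - B s w)%R.

Lemma measurable_increment s t : measurable_fun setT (increment s t).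
Proof. by apply: measurable_funB. Qed.

Lemma measurable_preimage_increment s t C : measurable C ->
  measurable (increment s t @^-1` C).
Proof.
by move=> mC; rewrite -(setTI (_ @^-1` _)); exact: measurable_increment.
Qed.

(** The sigma-algebra before right-continuous regularisation: [brownian_filtration B t] is the
    intersection of the [past s] over s > t. *)
Definition past (s : R) : set_system T :=
  <<s null_sets P `|`
      \bigcup_(u in `[0%R, s]) preimage_set_system setT (B u) measurable >>.

Lemma past_measurable s : past s `<=` measurable.
Proof.
apply: smallest_sub; first exact: sigma_algebra_measurable.
move=> A [[]//|[u _ [C mC <-]]].
by rewrite setTI; exact: measurable_funPTI.
Qed.

(** The constraints are indexed by the times themselves rather than by positions in [us], so that
    intersecting two cylinders only concatenates the lists of times. *)
Definition cylinder (us : seq R) (C : R -> set R) : set T :=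
  \bigcap_(u in [set` us]) (B u @^-1` C u).

Lemma measurable_cylinder us C : (forall u, measurable (C u)) ->
  measurable (cylinder us C).
Proof.
move=> mC; apply: fin_bigcap_measurable => // u _.
exact: measurable_funPTI.
Qed.

Lemma cylinderI us vs C D : cylinder us C `&` cylinder vs D =
  cylinder (us ++ vs)
    (fun u => (if u \in us then C u else setT) `&`
              (if u \in vs then D u else setT)).
Proof.
apply/seteqP; split => w /=.
  by move=> [Cw Dw] u /= _; split; case: ifPn => // ?; [exact: Cw|exact: Dw].
move=> CD; split => u /= uI; have := CD u; rewrite /= mem_cat uI ?orbT => /(_ isT).
  by case.
by case.
Qed.

Section grid.
Variables (n : nat) (t : nat -> R).
Hypothesis t0 : t 0%N = 0%R.
Hypothesis t_lt : forall i, (i < n.+1)%N -> (t i < t i.+1)%R.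

(** A pi-system generating the sigma-algebra of the first n increments. *)
Let incr_rect : set_system T := [set A | exists2 C : nat -> set R,
  forall i, measurable (C i) &
  A = [set w | forall i, (i < n)%N -> C i (increment (t i) (t i.+1) w)]].

Let incr_rectT : incr_rect setT.
Proof. by exists (fun=> setT) => //; apply/seteqP; split. Qed.

Let incr_rectI : setI_closed incr_rect.
Proof.
move=> _ _ [C mC ->] [D mD ->]; exists (fun i => C i `&` D i).
  by move=> i; exact: measurableI.
apply/seteqP; split => w /=.
  by move=> [Cw Dw] i ni; split; [exact: Cw|exact: Dw].
by move=> CD; split => i /CD[].
Qed.

Let incr_rectE C : [set w | forall i, (i < n)%N -> C i (increment (t i) (t i.+1) w)] =
  \bigcap_(i in `I_n) (increment (t i) (t i.+1) @^-1` C i).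
Proof. by []. Qed.

Let incr_rect_measurable : incr_rect `<=` measurable.
Proof.
move=> _ [C mC ->]; rewrite incr_rectE.
apply: bigcap_measurableType => i _.
exact: measurable_preimage_increment.
Qed.

Let incr_rect_indep A C : incr_rect A -> measurable C ->
  P (A `&` increment (t n) (t n.+1) @^-1` C) =
  P A * P (increment (t n) (t n.+1) @^-1` C).
Proof.
move=> [D mD ->] mC.
have indep := brownian_indep hB (n := n.+1) (t := t) _ t_lt.
have prodE (C' : set R) : measurable C' ->
  P ([set w | forall i, (i < n)%N -> D i (increment (t i) (t i.+1) w)]
      `&` increment (t n) (t n.+1) @^-1` C') =
  (\prod_(i < n) P (increment (t i) (t i.+1) @^-1` D i)) *
    P (increment (t n) (t n.+1) @^-1` C').
  move=> mC'; have := indep _ (fun i : 'I_n.+1 => if (i < n)%N then D i else C').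
  rewrite t0 lexx => /(_ isT) h.
  rewrite big_ord_recr/= ltnn in h.
  under [in RHS]eq_bigr => i _.
    rewrite (_ : D i = if (i < n)%N then D i else C'); last by rewrite ltn_ord.
    over.
  rewrite -h; last by move=> i; case: ifP.
  congr (P _); apply/seteqP; split => w /=.
    move=> [Dw Cw] i _ /=; case: ifPn => ni; first exact: Dw.
    have -> : i = n :> nat by apply/eqP; rewrite eqn_leq -ltnS ltn_ord leqNgt.
    exact: Cw.
  move=> Dw; split.
    move=> i ni; have := Dw (widen_ord (leqnSn n) (Ordinal ni)) Logic.I.
    by rewrite /= ni.
  by have := Dw ord_max Logic.I; rewrite /= ltnn.
rewrite prodE//; congr (_ * _).
(* Leaving the last increment unconstrained identifies the product over the first n increments as
   the probability of the rectangle. *)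
have := prodE setT measurableT.
by rewrite !preimage_setT setIT probability_setT mule1 => ->.
Qed.

(** Off the null set where B_0 is nonzero, each B_(t_k) is the sum of the first k increments. So the
    cylinder agrees there with [cyl0], which lies in the sigma-algebra generated by the first n
    increments. *)
Lemma grid_independent (us : seq R) (C : R -> set R) (D : set R) :
  {subset us <= [seq t i | i <- iota 0 n.+1]} ->
  (forall u, measurable (C u)) -> measurable D ->
  P (cylinder us C `&` increment (t n) (t n.+1) @^-1` D) =
  P (cylinder us C) * P (increment (t n) (t n.+1) @^-1` D).
Proof.
move=> ust mC mD.
have mE := measurable_preimage_increment (t n) (t n.+1) mD.
pose cyl0 := \bigcap_(u in [set` us]) (increment 0%R u @^-1` C u).
have mincr i : (i < n)%N ->
    measurable_fun [set: g_sigma_algebraType incr_rect]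
      (increment (t i) (t i.+1) : g_sigma_algebraType incr_rect -> R).
  move=> ni _ A mA; rewrite setTI; apply: sub_sigma_algebra.
  exists (fun j => if j == i then A else setT) => [j|]; first by case: ifP.
  apply/seteqP; split => w /=.
    by move=> Aw j _; case: eqP => // ->.
  by move=> /(_ i ni); rewrite eqxx.
have mB k : (k < n.+1)%N ->
    measurable_fun [set: g_sigma_algebraType incr_rect]
      (increment 0%R (t k) : g_sigma_algebraType incr_rect -> R).
  elim: k => [_|k IH kn].
    rewrite t0 /increment (_ : (fun _ => _) = cst 0%R)//.
    by apply/funext => w; rewrite subrr.
  rewrite (_ : increment _ _ = (fun w => increment 0%R (t k) w +
                                         increment (t k) (t k.+1) w)%R).
    apply: measurable_funD; first by apply: IH; exact: ltnW.
    by apply: mincr.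
  by apply/funext => w; rewrite /increment; ring.
have cyl0G : <<s incr_rect >> cyl0.
  have : @measurable _ (g_sigma_algebraType incr_rect) cyl0.
    apply: fin_bigcap_measurable => // u /= /ust/mapP[k]. 
    rewrite mem_iota/= add0n => kn ->.
    by rewrite -(setTI (_ @^-1` _)); exact: mB.
  by [].
have mcyl0 : measurable cyl0.
  apply: fin_bigcap_measurable => // u _; exact: measurable_preimage_increment.
have mcyl := measurable_cylinder us mC.
have [N [mN N0 BN]] := brownian_start hB.
have cylN : cylinder us C `\` N = cyl0 `\` N.
  have B0 w : ~ N w -> B 0%R w = 0%R.
    by move=> Nw; apply: contrapT => B0; apply: Nw; exact: BN.
  by apply/seteqP; split => w [cw Nw]; split => // u /cw; rewrite /increment/= B0// subr0.
rewrite (eq_prob_off_null mN mcyl mcyl0 N0 cylN).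
rewrite (@eq_prob_off_null _ _ _ _ _ _ (cyl0 `&` increment (t n) (t n.+1) @^-1` D) mN)//.
- by apply: (independent_sigma_algebra mE) cyl0G => // A GA; exact: incr_rect_indep.
- exact: measurableI.
- exact: measurableI.
- by rewrite !setDE [LHS]setIAC [RHS]setIAC -!setDE cylN.
Qed.

End grid.

Lemma cylinder_independent (s t : R) (us : seq R) (C : R -> set R) (D : set R) :
  (0 <= s < t)%R -> {in us, forall u, 0 <= u <= s}%R ->
  (forall u, measurable (C u)) -> measurable D ->
  P (cylinder us C `&` increment s t @^-1` D) =
  P (cylinder us C) * P (increment s t @^-1` D).
Proof.
move=> /andP[s0 st] us0s mC mD.
(* Adding 0 and [s] to the times gives a grid that starts at 0 and whose last point is [s]. *)
pose vs := sort <=%R (undup [:: 0, s & us])%R.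
have memvs : vs =i [:: 0, s & us]%R by move=> u; rewrite mem_sort mem_undup.
have vs0s u : u \in vs -> (0 <= u <= s)%R.
  rewrite memvs !inE => /orP[/eqP->|/orP[/eqP->|/us0s//]].
  - by rewrite lexx.
  - by rewrite s0 lexx.
have ltvs : sorted <%R vs.
  by rewrite lt_sorted_uniq_le sort_uniq undup_uniq sort_le_sorted.
have [n vsn] : exists n, size vs = n.+1.
  have : (0 < size vs)%N.
    rewrite lt0n size_eq0; apply/eqP => v0.
    by have := memvs 0%R; rewrite v0 !inE eqxx.
  by case: size => // n _; exists n.
(* The default value [t] of [nth] supplies the grid point that follows [s], so the last increment is
   the one from [s] to [t]. *)
pose tt i := nth t vs i.
have tt_lt i : (i < n.+1)%N -> (tt i < tt i.+1)%R.
  rewrite leq_eqVlt => /orP[/eqP[->]|ni].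
    rewrite /tt (nth_default _ (s := vs) (n := n.+1)) ?vsn//.
    have : nth t vs n \in vs by rewrite mem_nth// vsn.
    by move=> /vs0s/andP[_] /le_lt_trans; apply.
  by apply: (sortedP t) ltvs _ _; rewrite vsn.
have ttin i : (i < n.+1)%N -> tt i \in vs by move=> ni; rewrite mem_nth// vsn.
have ttmono i j : (i <= j <= n)%N -> (tt i <= tt j)%R.
  by move=> /andP[ij jn]; rewrite (lt_sorted_leq_nth _ ltvs)// inE vsn ltnS// (leq_trans ij).
have inv u : u \in vs -> exists2 i, (i < n.+1)%N & u = tt i.
  by move=> uvs; exists (index u vs); rewrite -?vsn ?index_mem// /tt nth_index.
have tt0 : tt 0%N = 0%R.
  have [|i ni E0] := inv 0%R; first by rewrite memvs inE eqxx.
  apply/eqP; rewrite eq_le; apply/andP; split; last by have /vs0s/andP[] := ttin _ (ltn0Sn n).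
  by rewrite E0 ttmono.
have ttn : tt n = s.
  have [|i ni Es] := inv s; first by rewrite memvs !inE eqxx orbT.
  apply/eqP; rewrite eq_le; apply/andP; split; first by have /vs0s/andP[] := ttin _ (ltnSn n).
  by rewrite [leLHS]Es ttmono// leqnn andbT.
have ttSn : tt n.+1 = t by rewrite /tt nth_default// vsn.
rewrite -ttn -ttSn; apply: grid_independent => // u uus.
have [|i ni ->] := inv u; first by rewrite memvs !inE uus !orbT.
by apply/mapP; exists i => //; rewrite mem_iota add0n.
Qed.

Lemma past_independent (s t : R) (A : set T) (D : set R) :
  (0 <= s < t)%R -> past s A -> measurable D ->
  P (A `&` increment s t @^-1` D) = P A * P (increment s t @^-1` D).
Proof.
move=> st pA mD; have /andP[s0 _] := st.
have mE := measurable_preimage_increment s t mD.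
(* The generators of [past] are not closed under intersection. Sets agreeing with a cylinder off a
   null set are, and they include both the null sets and the preimages under single B_u. *)
pose G : set_system T := [set A | measurable A /\
  exists us C N, [/\ {in us, forall u, 0 <= u <= s}%R,
    forall u, measurable (C u), null_sets P N & A `\` N = cylinder us C `\` N]].
have null0 : null_sets P set0 by split.
apply: (@independent_sigma_algebra _ _ _ _ G) => //.
- by move=> ? [].
- move=> A1 A2 [mA1 [us1 [C1 [N1 [us1s mC1 [mN1 N10] A1N]]]]].
  move=> [mA2 [us2 [C2 [N2 [us2s mC2 [mN2 N20] A2N]]]]].
  split; first exact: measurableI.
  exists (us1 ++ us2), (fun u => (if u \in us1 then C1 u else setT) `&`
              (if u \in us2 then C2 u else setT)), (N1 `|` N2); split.
  + by move=> u; rewrite mem_cat => /orP[/us1s|/us2s].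
  + by move=> u; apply: measurableI; case: ifP.
  + split; first exact: measurableU.
    apply/eqP; rewrite eq_le measure_ge0 andbT.
    by rewrite (le_trans (measureU2 _ _ _))// [X in X + _]N10 [X in _ + X]N20 adde0.
  + rewrite -cylinderI.
    have setDIU (X1 X2 : set T) : (X1 `&` X2) `\` (N1 `|` N2) =
        (X1 `\` N1) `&` (X2 `\` N2).
      by rewrite !setDE setCU setIACA.
    by rewrite [LHS]setDIU A1N A2N -setDIU.
- split=> //; exists [::], (fun=> setT), set0; split => //.
  by congr (_ `\` _); apply/seteqP; split.
- move=> A' [mA' [us [C [N [uss mC [mN N0] A'N]]]]].
  have mcyl := measurable_cylinder us mC.
  rewrite (eq_prob_off_null mN mA' mcyl N0 A'N).
  rewrite (@eq_prob_off_null _ _ _ _ _ _ (cylinder us C `&` increment s t @^-1` D) mN)//.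
  + exact: cylinder_independent.
  + exact: measurableI.
  + exact: measurableI.
  + by rewrite !setDE [LHS]setIAC [RHS]setIAC -!setDE A'N.
- apply: sub_sigma_algebra2 pA => A' [[mN N0]|[u us [C mC <-]]].
    (* A null set is compared with the empty cylinder, obtained from an impossible constraint at
       time 0. *)
    split => //; exists [:: 0%R], (fun=> set0), A'; split => //.
    + by move=> u; rewrite inE => /eqP ->; rewrite lexx.
    + rewrite setDv; apply/esym/seteqP; split => // w [/(_ 0%R) /=].
      by rewrite inE eqxx => /(_ isT).
  rewrite setTI; split; first exact: measurable_funPTI.
  exists [:: u], (fun=> C), set0; split => //.
  + by move=> v; rewrite inE => /eqP ->; move: us; rewrite /= in_itv.
  + congr (_ `\` _); apply/seteqP; split => w /=.
      by move=> Cw v; rewrite /= inE => /eqP ->.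
    by move=> /(_ u) /=; rewrite inE eqxx => /(_ isT).
Qed.

End brownian_past.

Lemma norm_mul_le_sqrD (R : realDomainType) (x y : R) :
  `|x * y| <= x ^+ 2 + y ^+ 2.
Proof.
have := sqr_ge0 (x + y); have := sqr_ge0 (x - y).
have := sqr_ge0 x; have := sqr_ge0 y.
rewrite sqrrB sqrrD ler_norml => ? ? ? ?; apply/andP; split; lra.
Qed.

(** * Expectations of nonnegative functions with values in [0, +oo] *)

Section nonnegative_expectation.
Context d (T : measurableType d) (R : realType) (P : probability T R).
Implicit Types f g : T -> R.
Local Open Scope ereal_scope.

Lemma ge0_expectationD f g : measurable_fun setT f -> measurable_fun setT g ->
  (forall x, 0 <= f x)%R -> (forall x, 0 <= g x)%R ->
  'E_P[fun x => (f x + g x)%R] = 'E_P[f] + 'E_P[g].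
Proof.
move=> mf mg f0 g0; rewrite unlock -ge0_integralD//; try exact/measurable_EFinP.
- by move=> x _; rewrite lee_fin.
- by move=> x _; rewrite lee_fin.
Qed.

Lemma ge0_expectationZl f (k : R) : measurable_fun setT f -> (0 <= k)%R ->
  (forall x, 0 <= f x)%R -> 'E_P[fun x => (k * f x)%R] = k%:E * 'E_P[f].
Proof.
move=> mf k0 f0; rewrite unlock -ge0_integralZl//; try exact/measurable_EFinP.
by move=> x _; rewrite lee_fin.
Qed.

Lemma ge0_expectation_le f g : measurable_fun setT f -> measurable_fun setT g ->
  (forall x, 0 <= f x)%R -> (forall x, f x <= g x)%R -> 'E_P[f] <= 'E_P[g].
Proof.
move=> mf mg f0 fg; rewrite unlock ge0_le_integral//; try exact/measurable_EFinP.
- by move=> x _; rewrite lee_fin.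
- by move=> x _; rewrite lee_fin.
Qed.

Lemma expectation_sqr_ge0 f : 0 <= 'E_P[fun x => (f x ^+ 2)%R].
Proof. by apply: expectation_ge0 => x; exact: sqr_ge0. Qed.

Lemma expectation_sqrD_le f g : measurable_fun setT f -> measurable_fun setT g ->
  'E_P[fun x => ((f x + g x) ^+ 2)%R] <=
  2%:E * 'E_P[fun x => (f x ^+ 2)%R] + 2%:E * 'E_P[fun x => (g x ^+ 2)%R].
Proof.
move=> mf mg.
have mf2 := measurable_funX 2 mf; have mg2 := measurable_funX 2 mg.
have mX2 (h : T -> R) : measurable_fun setT h -> measurable_fun setT (fun x => 2 * h x ^+ 2)%R.
  by move=> mh; apply: measurable_funM => //; exact: measurable_funX.
rewrite -!ge0_expectationZl//; try by move=> x; exact: sqr_ge0.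
rewrite -ge0_expectationD; try by move=> x; rewrite mulr_ge0 ?sqr_ge0.
- apply: ge0_expectation_le.
  + by apply: measurable_funX; exact: measurable_funD.
  + by apply: measurable_funD; exact: mX2.
  + by move=> x; exact: sqr_ge0.
  + move=> x; rewrite -subr_ge0 [leRHS](_ : _ = (f x - g x) ^+ 2)%R ?sqr_ge0//; ring.
- exact: mX2.
- exact: mX2.
Qed.

Lemma Lfun2P f :
  f \in Lfun P 2%:E <->
  measurable_fun setT f /\ 'E_P[fun x => (f x ^+ 2)%R] < +oo.
Proof.
split=> [fL|[mf foo]].
  split; first by move: fL; rewrite inE => /andP[/[!inE]].
  have /integrableP[_] := Lfun2_integrable_sqr fL.
  rewrite unlock; apply: le_lt_trans.
  by under [leRHS]eq_integral => x _ do rewrite gee0_abs ?lee_fin ?sqr_ge0//.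
rewrite inE; apply/andP; split; rewrite inE//=.
rewrite /finite_norm unlock/= (_ : \int[P]_x _ = 'E_P[fun x => (f x ^+ 2)%R]).
  rewrite -[ltLHS]/(poweR _ _) poweR_lty//.
rewrite [in RHS]unlock; apply: eq_integral => x _.
by rewrite /= powR_mulrn// real_normK// num_real.
Qed.

End nonnegative_expectation.

(** * One step of the second-moment identity, relative to a sub-sigma-algebra *)

Section conditioning.
Context d (T : measurableType d) (R : realType) (P : probability T R).
Variables (F : set_system T).
Hypothesis sF : sigma_algebra setT F.
Hypothesis Fm : F `<=` measurable.
Local Open Scope ereal_scope.

(** Stated through [g_sigma_algebraType] so that the closure properties of measurable functions
    apply to [F]; [adapted_funP] gives the form with preimages. *)
Definition adapted_fun (f : T -> R) :=
  measurable_fun [set: g_sigma_algebraType F] (f : g_sigma_algebraType F -> R).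

Lemma adapted_funP f :
  adapted_fun f <-> forall A : set R, measurable A -> F (f @^-1` A).
Proof.
have FE : @measurable _ (g_sigma_algebraType F) = F by exact: sigma_algebra_id.
by split => [mf A mA|Ff _ A mA]; [have := mf measurableT A mA|]; rewrite setTI FE//; exact: Ff.
Qed.

Lemma adapted_fun_measurable f : adapted_fun f -> measurable_fun setT f.
Proof. by move=> /adapted_funP Ff _ A mA; rewrite setTI; apply/Fm/Ff. Qed.

(** The hypothesis says that X has conditional expectation c given [F]: on [F], the measure with
    density X equals c P. Integrating the [F]-measurable W against this one measure, seen with
    density X and with constant density c, gives the two sides. *)
Lemma expectation_weight (X W : T -> R) (c : R) : (0 <= c)%R ->
  measurable_fun setT X -> (forall w, 0 <= X w)%R ->
  (forall A, F A -> 'E_P[fun w => (X w * \1_A w)%R] = c%:E * P A) ->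
  adapted_fun W -> (forall w, 0 <= W w)%R ->
  'E_P[fun w => (W w * X w)%R] = c%:E * 'E_P[W].
Proof.
move=> c0 mX X0 EX aW W0.
have FE : @measurable _ (g_sigma_algebraType F) = F by exact: sigma_algebra_id.
have mid : measurable_fun [set: T] (id : T -> g_sigma_algebraType F).
  by move=> _ A; rewrite setTI FE => /Fm.
pose idF : T -> g_sigma_algebraType F := id.
(* The restriction of P to [F] is realised as its image under the identity map into the coarser
   measurable space. *)
pose nu0 : {measure set (g_sigma_algebraType F) -> \bar R} :=
  mscale (NngNum c0) (pushforward P idF).
pose nu := nu0 mid.
have nuE (p : T -> R) : (forall A, F A -> nu A = 'E_P[fun w => (p w * \1_A w)%R]) ->
    forall A : set (g_sigma_algebraType F), measurable A ->
    nu A = \int[P]_(x in idF @^-1` A) (p x)%:E.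
  move=> pE A; rewrite FE => FA; rewrite pE// unlock [RHS]integral_mkcond.
  apply: eq_integral => w _; rewrite patchE indicE.
  by case: ifPn => _; rewrite ?mulr1 ?mulr0.
have EFA A : F A -> 'E_P[fun w => (c * \1_A w)%R] = c%:E * P A.
  move=> FA; rewrite ge0_expectationZl//; last exact/measurable_indicP/Fm.
  by rewrite unlock integral_indic ?setIT//; exact: Fm.
rewrite -ge0_expectationZl//; last exact: adapted_fun_measurable.
have nuX := nuE X (fun A FA => esym (EX A FA)).
have nuc := nuE (fun=> c) (fun A FA => esym (EFA A FA)).
rewrite unlock; transitivity (\int[nu]_w (W w)%:E).
  by rewrite (ge0_integral_density mid mX X0 nuX aW W0).
rewrite (ge0_integral_density mid (measurable_cst _) (fun=> c0) nuc aW W0).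
by apply: eq_integral => w _; rewrite mulrC.
Qed.

(** Formally the cross term 2 f Z X has expectation 0, since the hypotheses give X conditional mean
    0. As it need not be integrable, the equality is first proved when f Z is integrable, then used
    on truncations to bound the left side from below, which settles the case of an infinite right
    side. *)
Lemma expectation_sqr_step (f Z X : T -> R) (c : R) : (0 < c)%R ->
  measurable_fun setT X ->
  (forall A, F A -> 'E_P[fun w => (X w ^+ 2 * \1_A w)%R] = c%:E * P A) ->
  (forall A, F A ->
    'E_P[fun w => ((X w + 1) ^+ 2 * \1_A w)%R] = (c + 1)%:E * P A) ->
  adapted_fun f -> adapted_fun Z ->
  'E_P[fun w => ((f w + Z w * X w) ^+ 2)%R] =
  'E_P[fun w => (f w ^+ 2)%R] + c%:E * 'E_P[fun w => (Z w ^+ 2)%R].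
Proof.
move=> c0 mX EX2 EX1 af aZ.
have cr0 := ltW c0.
have aM (g h : T -> R) : adapted_fun g -> adapted_fun h ->
    adapted_fun (fun w => g w * h w)%R by exact: measurable_funM.
have mX1 : measurable_fun setT (fun w => X w + 1)%R by exact: measurable_funD.
have EX2' : forall A, F A ->
    'E_P[fun w => ((X w ^+ 2 + 1) * \1_A w)%R] = (c + 1)%:E * P A.
  move=> A FA; have mA := Fm FA.
  have mI : measurable_fun setT (\1_A : T -> R) by exact/measurable_indicP.
  under [X in 'E_P[X]]eq_fun do rewrite mulrDl mul1r.
  rewrite ge0_expectationD//.
  - rewrite EX2// EFinD ge0_muleDl ?lee_fin// mul1e; congr +%E.
    by rewrite unlock integral_indic ?setIT.
  - by apply: measurable_funM => //; exact: measurable_funX.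
  - by move=> w; rewrite mulr_ge0 ?sqr_ge0.
(* With p and q the positive and negative parts of gh,
   (g + hX)^2 + p (X^2 + 1) + q (X + 1)^2
     = g^2 + h^2 X^2 + p (X + 1)^2 + q (X^2 + 1),
   where every term is nonnegative and a product of an F-measurable factor and
   of X^2, X^2 + 1 or (X + 1)^2; the terms in p and q cancel if E|gh| is finite. *)
have finite_case (g h : T -> R) : adapted_fun g -> adapted_fun h ->
    'E_P[fun w => `|g w * h w|%R] < +oo ->
    'E_P[fun w => ((g w + h w * X w) ^+ 2)%R] =
    'E_P[fun w => (g w ^+ 2)%R] + c%:E * 'E_P[fun w => (h w ^+ 2)%R].
  move=> ag ah foo.
  pose p w := Num.max (g w * h w)%R 0%R; pose q w := Num.max (- (g w * h w))%R 0%R.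
  have ap : adapted_fun p by apply: measurable_maxr => //; exact: aM.
  have aq : adapted_fun q.
    by apply: measurable_maxr => //; apply: measurableT_comp => //; exact: aM.
  have p0 w : (0 <= p w)%R by rewrite le_max lexx orbT.
  have q0 w : (0 <= q w)%R by rewrite le_max lexx orbT.
  have pqN w : (p w + q w = `|g w * h w|)%R.
    rewrite /p /q; case: (leP 0 (g w * h w))%R => gh.
      by rewrite max_r ?oppr_le0// addr0 ger0_norm.
    by rewrite add0r max_l ?ltr0_norm// oppr_ge0 ltW.
  have pqB w : (p w - q w = g w * h w)%R.
    rewrite /p /q; case: (leP 0 (g w * h w))%R => gh.
      by rewrite max_r ?oppr_le0// subr0.
    by rewrite sub0r max_l ?opprK// oppr_ge0 ltW.
  have mm := adapted_fun_measurable.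
  have mg := mm _ ag; have mh := mm _ ah; have mp := mm _ ap; have mq := mm _ aq.
  have mX2 : measurable_fun setT (fun w => X w ^+ 2)%R by exact: measurable_funX.
  have mX21 : measurable_fun setT (fun w => X w ^+ 2 + 1)%R by exact: measurable_funD.
  have mX12 : measurable_fun setT (fun w => (X w + 1) ^+ 2)%R by exact: measurable_funX.
  have X20 w : (0 <= X w ^+ 2)%R by exact: sqr_ge0.
  have X210 w : (0 <= X w ^+ 2 + 1)%R by rewrite addr_ge0.
  have X120 w : (0 <= (X w + 1) ^+ 2)%R by exact: sqr_ge0.
  have c10 : (0 <= c + 1)%R by rewrite addr_ge0.
  have mh2 : measurable_fun setT (fun w => h w ^+ 2)%R by exact: measurable_funX.
  have mg2 : measurable_fun setT (fun w => g w ^+ 2)%R by exact: measurable_funX.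
  have h20 w : (0 <= h w ^+ 2)%R by exact: sqr_ge0.
  have g20 w : (0 <= g w ^+ 2)%R by exact: sqr_ge0.
  pose S w := ((g w + h w * X w) ^+ 2)%R.
  have S0 w : (0 <= S w)%R by exact: sqr_ge0.
  have mS : measurable_fun setT S.
    by apply: measurable_funX; apply: measurable_funD => //; exact: measurable_funM.
  have mpX2 : measurable_fun setT (fun w => p w * (X w ^+ 2 + 1))%R by exact: measurable_funM.
  have mqX2 : measurable_fun setT (fun w => q w * (X w ^+ 2 + 1))%R by exact: measurable_funM.
  have mpX1 : measurable_fun setT (fun w => p w * (X w + 1) ^+ 2)%R by exact: measurable_funM.
  have mqX1 : measurable_fun setT (fun w => q w * (X w + 1) ^+ 2)%R by exact: measurable_funM.
  have mhX : measurable_fun setT (fun w => h w ^+ 2 * X w ^+ 2)%R by exact: measurable_funM.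
  have ah2 : adapted_fun (fun w => h w ^+ 2)%R by exact: measurable_funX.
  have eqE : 'E_P[fun w => (S w + (p w * (X w ^+ 2 + 1) + q w * (X w + 1) ^+ 2))%R] =
    'E_P[fun w => ((g w ^+ 2 + h w ^+ 2 * X w ^+ 2) +
                   (p w * (X w + 1) ^+ 2 + q w * (X w ^+ 2 + 1)))%R].
    congr expectation; apply/funext => w; rewrite /S.
    apply/eqP; rewrite -subr_eq0; apply/eqP.
    transitivity (2 * X w * (g w * h w - (p w - q w)))%R; first ring.
    by rewrite pqB subrr mulr0.
  move: eqE; rewrite !ge0_expectationD//; last 12 first.
  all: try by move=> w; rewrite ?addr_ge0 ?(mulr_ge0 (p0 w)) ?(mulr_ge0 (q0 w)) ?(mulr_ge0 (h20 w)).
  all: try by apply: measurable_funD.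
  rewrite (expectation_weight c10 mX21 X210 EX2' ap p0).
  rewrite (expectation_weight c10 mX21 X210 EX2' aq q0).
  rewrite (expectation_weight c10 mX12 X120 EX1 ap p0).
  rewrite (expectation_weight c10 mX12 X120 EX1 aq q0).
  rewrite (expectation_weight cr0 mX2 X20 EX2 ah2 h20).
  have pqfin : (c + 1)%:E * 'E_P[p] + (c + 1)%:E * 'E_P[q] \is a fin_num.
    rewrite -ge0_muleDr ?expectation_ge0// -ge0_expectationD//.
    rewrite fin_numM// ge0_fin_numE; last by apply: expectation_ge0 => w; rewrite addr_ge0.
    by under [X in 'E_P[X]]eq_fun do rewrite pqN.
  by move=> /(congr1 (fun x => x - ((c + 1)%:E * 'E_P[p] + (c + 1)%:E * 'E_P[q]))); rewrite !addeK.
have mf := adapted_fun_measurable af; have mZ := adapted_fun_measurable aZ.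
have mf2 := measurable_funX 2 mf; have mZ2 := measurable_funX 2 mZ.
pose H w := (f w ^+ 2 + c * Z w ^+ 2)%R.
have H0 w : (0 <= H w)%R by rewrite addr_ge0 ?(mulr_ge0 cr0) ?sqr_ge0.
have mcZ2 : measurable_fun setT (fun w => c * Z w ^+ 2)%R by exact: measurable_funM.
have mH : measurable_fun setT H by exact: measurable_funD.
have EH : 'E_P[H] = 'E_P[fun w => (f w ^+ 2)%R] + c%:E * 'E_P[fun w => (Z w ^+ 2)%R].
  rewrite ge0_expectationD//.
  - by rewrite ge0_expectationZl// => w; exact: sqr_ge0.
  - by move=> w; exact: sqr_ge0.
  - by move=> w; rewrite mulr_ge0 ?sqr_ge0.
rewrite -EH.
pose S w := ((f w + Z w * X w) ^+ 2)%R.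
have mS : measurable_fun setT S.
  by apply: measurable_funX; apply: measurable_funD => //; exact: measurable_funM.
(* Truncation to {H <= n} gives the lower bound without integrability. *)
have HS : 'E_P[H] <= 'E_P[S].
  pose D n := [set w | (H w <= n%:R)%R].
  have aH : adapted_fun H.
    apply: measurable_funD; first exact: measurable_funX.
    by apply: measurable_funM => //; exact: measurable_funX.
  have FD n : F (D n).
    have /adapted_funP/(_ `]-oo, n%:R]%classic) := aH.
    rewrite (_ : _ @^-1` _ = D n); first by apply.
    by apply/seteqP; split => w; rewrite /= in_itv.
  have aI n : adapted_fun (\1_(D n)).
    by apply/measurable_indicP; exact: sub_sigma_algebra.
  have mI n : measurable_fun setT (\1_(D n) : T -> R) by exact/measurable_indicP/Fm.
  pose Hn n w := (H w * \1_(D n) w)%R.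
  have mHn n : measurable_fun setT (Hn n) by exact: measurable_funM.
  have Hn_le n : 'E_P[Hn n] <= 'E_P[S].
    (* As [D n] belongs to [F], the truncated functions stay adapted; off [D n] the truncated square
       is 0. *)
    pose fn w := (f w * \1_(D n) w)%R; pose Zn w := (Z w * \1_(D n) w)%R.
    have I2 w : (\1_(D n) w ^+ 2 = \1_(D n) w :> R)%R.
      by rewrite indicE; case: (_ \in _); rewrite ?expr1n ?expr0n.
    have -> : 'E_P[Hn n] = 'E_P[fun w => ((fn w + Zn w * X w) ^+ 2)%R].
      rewrite finite_case; [|exact: aM|exact: aM|].
        rewrite -ge0_expectationZl//; last first.
        - by move=> w; exact: sqr_ge0.
        - by apply: measurable_funX; exact: measurable_funM.
        rewrite -ge0_expectationD.
        - congr expectation; apply/funext => w.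
          by rewrite /Hn /H /fn /Zn !exprMn !I2; ring.
        - by apply: measurable_funX; exact: measurable_funM.
        - by apply: measurable_funM => //; apply: measurable_funX; exact: measurable_funM.
        - by move=> w; exact: sqr_ge0.
        - by move=> w; rewrite mulr_ge0 ?sqr_ge0.
      (* On [D n] one has f^2 <= H <= n and Z^2 <= H / c <= n / c. *)
      apply: (@le_lt_trans _ _ 'E_P[cst (n%:R * (1 + c^-1))%R]); last first.
        by rewrite expectation_cst ltry.
      apply: ge0_expectation_le => //.
      - apply: measurableT_comp => //; apply: measurable_funM; exact: measurable_funM.
      - move=> w /=; rewrite /fn /Zn indicE; case: (boolP (w \in D n)) => [|_].
          rewrite inE /D/= /H => Dw; rewrite !mulr1.
          apply: (@le_trans _ _ (f w ^+ 2 + Z w ^+ 2)%R).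
            exact: norm_mul_le_sqrD.
          rewrite mulrDr mulr1 lerD//.
            by apply: le_trans Dw; rewrite lerDl mulr_ge0 ?sqr_ge0.
          rewrite ler_pdivlMr// mulrC.
          by apply: le_trans Dw; rewrite lerDr sqr_ge0.
        by rewrite mulr0 mul0r normr0 mulr_ge0// addr_ge0// invr_ge0.
    apply: ge0_expectation_le => //.
    - apply: measurable_funX; apply: measurable_funD; first exact: measurable_funM.
      by apply: measurable_funM => //; exact: measurable_funM.
    - by move=> w; exact: sqr_ge0.
    - move=> w; rewrite /fn /Zn /S indicE; case: (_ \in _).
        by rewrite !mulr1.
      by rewrite !mulr0 mul0r addr0 expr0n/= sqr_ge0.
  have -> : 'E_P[H] = limn (fun n => 'E_P[Hn n]).
    rewrite unlock -monotone_convergence//; last 3 first.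
    - by move=> n; exact/measurable_EFinP.
    - by move=> n w _; rewrite lee_fin mulr_ge0.
    - move=> w _ m n mn; rewrite lee_fin ler_wpM2l// !indicE.
      case: (boolP (w \in D m)) => // /[!inE] Dm.
      rewrite (_ : w \in D n)// inE.
      by apply: le_trans Dm _; rewrite ler_nat.
    apply: eq_integral => w _; apply/esym/cvg_lim => //.
    apply: cvg_near_cst.
    have [N HN] : exists N, (H w <= N%:R)%R.
      by exists (Num.bound (H w)); exact: ltW (archi_boundP (H0 w)).
    exists N => // n /= Nn; rewrite /Hn indicE (_ : w \in D n) ?mulr1// inE.
    by apply: le_trans HN _; rewrite ler_nat.
  apply: lime_le; last by apply: nearW => n; exact: Hn_le.
  apply: ereal_nondecreasing_is_cvgn => m n mn.
  apply: ge0_expectation_le => //.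
  - by move=> w; rewrite mulr_ge0.
  - move=> w; rewrite ler_wpM2l// !indicE.
    case: (boolP (w \in D m)) => // /[!inE] Dm.
    rewrite (_ : w \in D n)// inE.
    by apply: le_trans Dm _; rewrite ler_nat.
(* If E H is infinite, the lower bound forces equality. Otherwise |f Z| <= f^2 + Z^2 <= (1 + 1/c) H
   is integrable and the first case applies. *)
have [Hoo|] := eqVneq 'E_P[H] +oo.
  by apply/eqP; rewrite eq_le HS andbT Hoo leey.
rewrite -ltey => Hfin; apply: etrans (esym EH); apply: finite_case => //.
apply: (@le_lt_trans _ _ 'E_P[fun w => ((1 + c^-1) * H w)%R]); last first.
  rewrite ge0_expectationZl ?addr_ge0 ?invr_ge0//.
  by rewrite lte_mul_pinfty ?lee_fin ?addr_ge0 ?invr_ge0.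
apply: ge0_expectation_le => //.
- by apply: measurableT_comp => //; exact: measurable_funM.
- exact: measurable_funM.
move=> w; apply: (@le_trans _ _ (f w ^+ 2 + Z w ^+ 2)%R).
  exact: norm_mul_le_sqrD.
rewrite mulrDl mul1r lerD//.
  by rewrite lerDl mulr_ge0 ?sqr_ge0.
rewrite -ler_pdivrMl ?invr_gt0// invrK.
by rewrite lerDr sqr_ge0.
Qed.

End conditioning.

(** * Brownian increments and the right-continuous filtration *)

Section brownian_increments.
Context d (T : measurableType d) (R : realType) (P : probability T R).
Variables (B : R -> {RV P >-> R}) (hB : is_brownian_motion B).
Local Open Scope ereal_scope.
Local Notation F := (brownian_filtration B).
Local Notation D := (increment B).

Lemma filtration_sub_past (t s : R) : (t < s)%R -> F t `<=` past B s.
Proof. by move=> ts A; apply; rewrite /= in_itv/= ts. Qed.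

Lemma filtration_sigma_algebra (t : R) : sigma_algebra setT (F t).
Proof. by apply: sigma_algebra_bigcap => s _; exact: smallest_sigma_algebra. Qed.

Lemma filtration_measurable (t : R) : F t `<=` measurable.
Proof.
by move=> A /(@filtration_sub_past t (t + 1)%R); rewrite ltrDl => /(_ ltr01)/past_measurable.
Qed.

Lemma filtration_le (s t : R) : (s <= t)%R -> F s `<=` F t.
Proof.
move=> st A As u /=; rewrite in_itv/= andbT => tu.
by apply: As; rewrite /= in_itv/= andbT (le_lt_trans st).
Qed.

Lemma adapted_fun_le (s t : R) (f : T -> R) : (s <= t)%R ->
  adapted_fun (F s) f -> adapted_fun (F t) f.
Proof.
move=> st /(adapted_funP (filtration_sigma_algebra s)) fs.
apply/(adapted_funP (filtration_sigma_algebra t)) => A /fs.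
exact: filtration_le.
Qed.

Lemma adapted_brownian (u t : R) : (0 <= u <= t)%R -> adapted_fun (F t) (B u).
Proof.
move=> /andP[u0 ut]; apply/(adapted_funP (filtration_sigma_algebra t)) => A mA s /=.
rewrite in_itv/= andbT => ts; apply: sub_sigma_algebra; right; exists u.
  by rewrite /= in_itv/= u0 (le_trans ut)// ltW.
by exists A => //; rewrite setTI.
Qed.

Lemma adapted_increment (r s t : R) : (0 <= r <= s)%R -> (s <= t)%R ->
  adapted_fun (F t) (D r s).
Proof.
move=> /andP[r0 rs] st; apply: measurable_funB; apply: adapted_brownian.
  by rewrite (le_trans r0)//.
by rewrite r0 (le_trans rs).
Qed.

Lemma expectation_increment (s t : R) (g : R -> R) : (0 <= s < t)%R ->
  measurable_fun setT g -> (forall x, 0 <= g x)%R ->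
  'E_P[fun w => g (D s t w)] = \int[normal_prob 0 (Num.sqrt (t - s))]_x (g x)%:E.
Proof.
move=> /andP[s0 st] mg g0.
transitivity (\int[P]_w (g (D s t w) * 1)%:E).
  by rewrite unlock; apply: eq_integral => w _; rewrite mulr1.
apply/esym; apply: (@ge0_integral_density _ _ T (measurableTypeR R) R (D s t)
  (measurable_increment B s t) P (normal_prob 0 _) (cst 1%R)) => //.
move=> A mA; rewrite (eq_integral (cst 1))// integral_cst ?mul1e//.
  exact: esym (brownian_gauss hB s0 st mA).
exact: measurable_preimage_increment.
Qed.

Lemma increment_sqr_le (s t : R) : (0 <= s < t)%R ->
  'E_P[fun w => (D s t w ^+ 2)%R] <= (8 * (t - s))%:E.
Proof.
move=> st; have /andP[_ st'] := st.
have r0 : (0 < Num.sqrt (t - s))%R by rewrite sqrtr_gt0 subr_gt0.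
rewrite (expectation_increment (g := fun x => x ^+ 2)%R st)//.
  by rewrite (le_trans (normal_second_moment_le r0))// sqr_sqrtr// subr_ge0 ltW.
by move=> x; exact: sqr_ge0.
Qed.

Lemma increment_sqr_gt0 (s t : R) : (0 <= s < t)%R ->
  0 < 'E_P[fun w => (D s t w ^+ 2)%R].
Proof.
move=> st; have /andP[_ st'] := st.
rewrite (expectation_increment (g := fun x => x ^+ 2)%R st)//.
  by apply: normal_second_moment_gt0; rewrite sqrtr_gt0 subr_gt0.
by move=> x; exact: sqr_ge0.
Qed.

Lemma increment_add1 (s t : R) : (0 <= s < t)%R ->
  'E_P[fun w => ((D s t w + 1) ^+ 2)%R] = 'E_P[fun w => (D s t w ^+ 2)%R] + 1.
Proof.
move=> st; have /andP[_ st'] := st.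
rewrite (expectation_increment (g := fun x => x ^+ 2)%R st)//; last first.
  by move=> x; exact: sqr_ge0.
rewrite (expectation_increment (g := fun x => (x + 1) ^+ 2)%R st)//.
- by apply: normal_moment_add1; rewrite sqrtr_gt0 subr_gt0.
- by apply: measurable_funX; exact: measurable_funD.
- by move=> x; exact: sqr_ge0.
Qed.

(** By independence, the image under the increment of P restricted to [A] is [P A] times the normal
    law; [g] is integrated against it. *)
Lemma past_expectation (s t : R) (g : R -> R) (A : set T) : (0 <= s < t)%R ->
  measurable_fun setT g -> (forall x, 0 <= g x)%R -> past B s A ->
  'E_P[fun w => (g (D s t w) * \1_A w)%R] = P A * 'E_P[fun w => g (D s t w)].
Proof.
move=> st mg g0 pA.
have mA : measurable A := past_measurable pA.
have PAfin : P A \is a fin_num by exact: fin_num_measure.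
have PA0 : (0 <= fine (P A))%R by exact: fine_ge0.
rewrite (expectation_increment st)//.
have lawE (C : set R) : measurable C ->
    mscale (NngNum PA0) (normal_prob 0 (Num.sqrt (t - s))) C =
    \int[P]_(x in D s t @^-1` C) (\1_A x)%:E.
  move=> mC; rewrite /mscale/= fineK//.
  have /andP[s0 st'] := st.
  transitivity (P (A `&` D s t @^-1` C)).
    rewrite (past_independent hB st pA mC); congr (_ * _).
    exact: esym (brownian_gauss hB s0 st' mC).
  by rewrite integral_indic//; exact: measurable_preimage_increment.
have := @ge0_integral_density _ _ T (measurableTypeR R) R (D s t)
  (measurable_increment B s t) P
  (mscale (NngNum PA0) (normal_prob 0 (Num.sqrt (t - s)))) (\1_A)
  (measurable_indic mA) (fun=> ler0n _ _) lawE g mg g0.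
rewrite ge0_integral_mscale//=; last 2 first.
- exact/measurable_EFinP.
- by move=> x _; rewrite lee_fin.
by rewrite fineK// unlock => <-.
Qed.

Lemma sqrD_le (x y e : R) : (0 < e)%R ->
  ((x + y) ^+ 2 <= (1 + e) * x ^+ 2 + (1 + e^-1) * y ^+ 2)%R.
Proof.
move=> e0; rewrite -subr_ge0.
rewrite [leRHS](_ : _ = e * (x - y / e) ^+ 2)%R; last by field; rewrite gt_eqF.
by rewrite mulr_ge0 ?sqr_ge0// ltW.
Qed.

(* For A in F_t and s > t, the increment from s to u is independent of A, and
   (x + y)^2 <= (1 + e) x^2 + (1 + 1/e) y^2 compares it with the increment from
   t to u.  Letting s -> t and then e -> 0 gives one inequality; applied to A and
   to its complement it yields the equality. *)
Section right_limit.
Variables (t u a : R).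
Hypothesis tu : (0 <= t < u)%R.
Let Q (s : R) (A : set T) := 'E_P[fun w => ((D s u w + a) ^+ 2 * \1_A w)%R].
Let q (s : R) := 'E_P[fun w => ((D s u w + a) ^+ 2)%R].

Let mDa s : measurable_fun setT (fun w => (D s u w + a) ^+ 2)%R.
Proof.
by apply: measurable_funX; apply: measurable_funD => //; exact: measurable_increment.
Qed.

Let q_lty s : (0 <= s < u)%R -> q s < +oo.
Proof.
move=> su; apply: le_lt_trans (expectation_sqrD_le _ _ _) _ => //.
  exact: measurable_increment.
rewrite [X in _ + _ * X](_ : _ = (a ^+ 2)%:E); last exact: expectation_cst.
rewrite lte_add_pinfty// lte_mul_pinfty ?ltry//.
exact: le_lt_trans (increment_sqr_le su) (ltry _).
Qed.

Let mD2 r s : measurable_fun setT (fun w => D r s w ^+ 2)%R.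
Proof. by apply: measurable_funX; exact: measurable_increment. Qed.

Let shift_le (r s e : R) (A : set T) (k : R) : (0 < e)%R -> measurable A ->
  'E_P[fun w => ((D r u w - D s u w) ^+ 2)%R] <= k%:E ->
  Q r A <= (1 + e)%:E * Q s A + ((1 + e^-1) * k)%:E.
Proof.
move=> e0 mA hk.
have e1 : (0 <= 1 + e)%R by rewrite addr_ge0 ?ltW.
have e1' : (0 <= 1 + e^-1)%R by rewrite addr_ge0 ?invr_ge0 ?ltW.
have mI : measurable_fun setT (\1_A : T -> R) by exact: measurable_indic.
have mdiff : measurable_fun setT (fun w => (D r u w - D s u w) ^+ 2)%R.
  by apply: measurable_funX; apply: measurable_funB; exact: measurable_increment.
apply: (@le_trans _ _ ((1 + e)%:E * Q s A +
    (1 + e^-1)%:E * 'E_P[fun w => ((D r u w - D s u w) ^+ 2)%R])); last first.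
  by rewrite leeD2l// EFinM lee_wpmul2l// lee_fin.
have I0 w : (0 <= \1_A w :> R)%R by [].
rewrite -!ge0_expectationZl//; first last.
- by move=> w; rewrite mulr_ge0 ?sqr_ge0.
- exact: measurable_funM.
- by move=> w; exact: sqr_ge0.
rewrite -ge0_expectationD; first last.
- by move=> w; rewrite mulr_ge0 ?sqr_ge0.
- by move=> w; rewrite (mulr_ge0 e1)// mulr_ge0 ?sqr_ge0.
- exact: measurable_funM.
- by apply: measurable_funM => //; exact: measurable_funM.
apply: ge0_expectation_le.
- exact: measurable_funM.
- by apply: measurable_funD; apply: measurable_funM => //; exact: measurable_funM.
- by move=> w; rewrite mulr_ge0 ?sqr_ge0.
move=> w; have := sqrD_le (D s u w + a) (D r u w - D s u w) e0.
rewrite (_ : _ + _ = D r u w + a)%R; last by ring.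
move=> h; rewrite indicE; case: (_ \in _); rewrite ?mulr1// ?mulr0 ?add0r.
by rewrite mulr_ge0 ?sqr_ge0.
Qed.

Let Q_le A : F t A -> Q t A <= P A * q t.
Proof.
move=> FA; have mA := filtration_measurable FA.
have /andP[t0 tu'] := tu.
have qt0 : 0 <= q t by exact: expectation_sqr_ge0.
have qtfin : q t \is a fin_num by rewrite ge0_fin_numE// q_lty.
have PAfin : P A \is a fin_num by exact: fin_num_measure.
set qt := fine (q t); set p := fine (P A).
have qtE : q t = qt%:E by rewrite fineK.
have pE : P A = p%:E by rewrite fineK.
have qt0' : (0 <= qt)%R by rewrite -lee_fin -qtE.
have p0 : (0 <= p)%R by rewrite -lee_fin -pE.
have p1 : (p <= 1)%R by rewrite -lee_fin -pE probability_le1.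
have h0 : (0 < u - t)%R by rewrite subr_gt0.
(* The constants come from (1 + e)^2 <= 1 + 3 e, p qt <= qt, and (2 + e) * 8 (e + e^2) <= 3 * 16
   e. *)
have key (e : R) : (0 < e < 1)%R -> Q t A <= (p * qt + e * (3 * qt + 48 * (u - t)))%:E.
  (* The gap s - t is of order e^2, so that the factor 1 + 1/e still leaves an error of order e. *)
  move=> /andP[e0 e1]; pose s := (t + e ^+ 2 * (u - t))%R.
  have e2 : (0 < e ^+ 2)%R by rewrite exprn_gt0.
  have e21 : (e ^+ 2 < 1)%R by rewrite expr_lt1// ltW.
  have ts : (t < s)%R by rewrite ltrDl mulr_gt0.
  have su : (s < u)%R by rewrite -ltrBrDl gtr_pMl.
  have s0 : (0 <= s)%R by rewrite (le_trans t0)// ltW.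
  have su0 : (0 <= s < u)%R by rewrite s0.
  have k1 : 'E_P[fun w => ((D t u w - D s u w) ^+ 2)%R] <= (8 * (s - t))%:E.
    rewrite (_ : (fun w => _) = (fun w => D t s w ^+ 2)%R).
      by apply: increment_sqr_le; rewrite t0.
    by apply/funext => w; rewrite /increment; ring.
  have k2 : 'E_P[fun w => ((D s u w - D t u w) ^+ 2)%R] <= (8 * (s - t))%:E.
    by under [X in 'E_P[X]]eq_fun do rewrite -sqrrN opprB.
  (* The comparison goes from [t] to [s] on [A], where independence yields [P A * q s], and then
     back from [s] to [t] on the whole space. *)
  have E1 := shift_le e0 mA k1.
  have E2 := shift_le e0 measurableT k2.
  have QT r : Q r setT = q r.
    by congr expectation; apply/funext => w; rewrite indicT mulr1.
  rewrite !QT in E2.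
  have QsA : Q s A = P A * q s.
    apply: (@past_expectation s u (fun x => (x + a) ^+ 2)%R A su0).
    - by apply: measurable_funX; exact: measurable_funD.
    - by move=> x; exact: sqr_ge0.
    - exact: filtration_sub_past FA.
  have qsfin : q s \is a fin_num.
    by rewrite ge0_fin_numE ?q_lty//; exact: expectation_sqr_ge0.
  rewrite QsA -(fineK qsfin) pE -!EFinM -EFinD in E1.
  rewrite -(fineK qsfin) qtE -!EFinM -EFinD lee_fin in E2.
  apply: (le_trans E1); rewrite lee_fin.
  set x := fine (q s) in E2 *.
  have stE : ((1 + e^-1) * (8 * (s - t)) = 8 * (e + e ^+ 2) * (u - t))%R.
    by rewrite /s; field; rewrite gt_eqF.
  rewrite stE in E2 *.
  have px : (p * x <= p * ((1 + e) * qt) + 8 * (e + e ^+ 2) * (u - t))%R.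
    apply: (le_trans (ler_wpM2l p0 E2)); rewrite mulrDr lerD2l ler_piMl//.
    by rewrite mulr_ge0 ?(ltW h0)// mulr_ge0// addr_ge0 ?ltW.
  apply: (@le_trans _ _ ((1 + e) * (p * ((1 + e) * qt) + 8 * (e + e ^+ 2) * (u - t)) +
      8 * (e + e ^+ 2) * (u - t)))%R.
    by rewrite lerD2r ler_wpM2l// addr_ge0 ?ltW.
  have pq : (p * qt <= qt)%R by rewrite ler_piMl.
  have ee : (e ^+ 2 <= e)%R by rewrite expr2 ler_piMl ?ltW.
  have eee : (e ^+ 2 * e <= e)%R by rewrite ler_piMl ?ltW.
  have pq0 : (0 <= p * qt)%R by rewrite mulr_ge0.
  have := ler_wpM2r (ltW h0) ee; have := ler_wpM2r (ltW h0) eee.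
  have := ler_wpM2r pq0 ee; have := ler_wpM2l (ltW e0) pq.
  nra.
rewrite qtE pE -EFinM; apply/lee_addgt0Pr => e e0.
pose M := (3 * qt + 48 * (u - t) + 1)%R.
have M1 : (1 <= M)%R by rewrite lerDr addr_ge0// mulr_ge0// ltW.
have M0 : (0 < M)%R by exact: lt_le_trans ltr01 M1.
have h01 : (0 < Num.min (e / M) (1 / 2) < 1)%R.
  apply/andP; split; first by rewrite lt_min !divr_gt0.
  by rewrite gt_min; apply/orP; right; lra.
apply: (le_trans (key _ h01)); rewrite -EFinD lee_fin lerD2l.
apply: (@le_trans _ _ (e / M * M)%R); last by rewrite divfK// gt_eqF.
apply: ler_pM => //.
- by move: h01 => /andP[/ltW].
- by rewrite addr_ge0// mulr_ge0// ltW.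
- by rewrite ge_min lexx.
- by rewrite lerDl.
Qed.

Lemma filtration_expectation A : F t A ->
  'E_P[fun w => ((D t u w + a) ^+ 2 * \1_A w)%R] =
  'E_P[fun w => ((D t u w + a) ^+ 2)%R] * P A.
Proof.
move=> FA; rewrite -/(Q t A) -/(q t) muleC.
have FAC : F t (~` A).
  by rewrite -setTD; have [_ + _] := filtration_sigma_algebra t; apply.
have mA := filtration_measurable FA.
have qt0 : 0 <= q t by exact: expectation_sqr_ge0.
have qtfin : q t \is a fin_num by rewrite ge0_fin_numE// q_lty.
have QD : Q t A + Q t (~` A) = q t.
  rewrite -ge0_expectationD.
  - congr expectation; apply/funext => w.
    by rewrite !indicE in_setC; case: (_ \in _); rewrite /= mulr1 mulr0 ?addr0 ?add0r.
  - by apply: measurable_funM => //; exact: measurable_indic.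
  - by apply: measurable_funM => //; apply: measurable_indic; exact: measurableC.
  - by move=> w; rewrite mulr_ge0 ?sqr_ge0.
  - by move=> w; rewrite mulr_ge0 ?sqr_ge0.
apply/eqP; rewrite eq_le Q_le//=.
have QC := Q_le FAC.
rewrite probability_setC// in QC.
have Q0 A' : 0 <= Q t A'.
  by apply: expectation_ge0 => w; rewrite mulr_ge0 ?sqr_ge0.
have PAfin : P A \is a fin_num by exact: fin_num_measure.
have QAfin : Q t A \is a fin_num.
  by rewrite ge0_fin_numE//; apply: le_lt_trans (Q_le FA) _; rewrite ltey_eq fin_numM.
have QCfin : Q t (~` A) \is a fin_num.
  by rewrite ge0_fin_numE//; apply: le_lt_trans QC _; rewrite ltey_eq fin_numM// fin_numB PAfin.
set x := fine (Q t A); set y := fine (Q t (~` A)); set p := fine (P A).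
have QAE : Q t A = x%:E by rewrite fineK.
have QCE : Q t (~` A) = y%:E by rewrite fineK.
have PAE : P A = p%:E by rewrite fineK.
rewrite -QD QAE QCE PAE (_ : 1 - p%:E = (1 - p)%:E)// in QC *.
move: QC; rewrite -!EFinD -!EFinM !lee_fin => QC; nra.
Qed.

End right_limit.

(** Induction on n: the partial sum and the last weight are both measurable for the filtration at
    [t n], so the last term is split off by [expectation_sqr_step]. *)
Lemma expectation_sqr_sum (n : nat) (t : nat -> R) (Psi : nat -> T -> R) :
  (0 <= t 0%N)%R -> (forall i, (i < n)%N -> (t i < t i.+1)%R) ->
  (forall i, (i < n)%N -> adapted_fun (F (t i)) (Psi i)) ->
  'E_P[fun w => ((\sum_(i < n) Psi i w * D (t i) (t i.+1) w) ^+ 2)%R] =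
  \sum_(i < n) 'E_P[fun w => (D (t i) (t i.+1) w ^+ 2)%R] *
               'E_P[fun w => (Psi i w ^+ 2)%R].
Proof.
move=> t0; elim: n => [|n IH] tlt aPsi.
  under [X in 'E_P[X]]eq_fun do rewrite big_ord0 expr0n/=.
  by rewrite big_ord0 -[RHS](expectation_cst P).
have tlt' i : (i < n)%N -> (t i < t i.+1)%R by move=> ni; apply/tlt/ltnW.
have tle : forall i j, (i <= j <= n)%N -> (t i <= t j)%R.
  move=> i; elim=> [|j IHj]; first by rewrite leqn0 => /andP[/eqP->].
  rewrite leq_eqVlt => /andP[/orP[/eqP->//|ij] jn].
  by apply: le_trans (IHj _) (ltW (tlt' _ jn)); rewrite -ltnS ij ltnW.
have tge0 i : (i <= n)%N -> (0 <= t i)%R.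
  by move=> ni; rewrite (le_trans t0)// tle.
have tn : (0 <= t n < t n.+1)%R by rewrite tge0//= tlt.
rewrite big_ord_recr/= -IH//; last by move=> i ni; apply: aPsi; exact: ltnW.
under [X in 'E_P[X]]eq_fun do rewrite big_ord_recr/=.
have EDfin : 'E_P[fun w => (D (t n) (t n.+1) w ^+ 2)%R] \is a fin_num.
  rewrite ge0_fin_numE ?expectation_sqr_ge0//.
  exact: le_lt_trans (increment_sqr_le tn) (ltry _).
rewrite -(fineK EDfin).
apply: (expectation_sqr_step (filtration_sigma_algebra (t n)) (@filtration_measurable _)).
- by apply: fine_gt0; rewrite increment_sqr_gt0// ltey_eq EDfin.
- exact: measurable_increment.
(* The shift [a] of [filtration_expectation] is 0 here and 1 in the next goal. *)
- move=> A FA; rewrite fineK//.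
  have := filtration_expectation 0 tn FA.
  under [X in 'E_P[X] = _]eq_fun do rewrite addr0.
  by under [X in _ = 'E_P[X] * _]eq_fun do rewrite addr0.
- move=> A FA; rewrite EFinD fineK// -increment_add1//.
  exact: filtration_expectation.
- apply: measurable_sum => i; apply: measurable_funM.
    apply: (@adapted_fun_le (t i)); first by rewrite tle// leqnn andbT ltnW.
    by apply: aPsi; rewrite ltnS ltnW.
  apply: adapted_increment; last by rewrite tle// ltn_ord leqnn.
  by rewrite tge0 1?ltnW//= ltW// tlt'.
- exact: aPsi.
Qed.

End brownian_increments.

(** * Sums over a refined grid *)

Section grid_sums.
Local Open Scope nat_scope.

(** Within each block of m consecutive indices the weight is constant and the increments telescope.
    Besides Brownian paths, it is applied to a k = k, where it counts fine cells. *)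
Lemma sum_coarse_increment (R : comNzRingType) (n m : nat) (a Y : nat -> R) :
  0 < m ->
  (\sum_(k < n * m) Y (k %/ m)%N * (a k.+1 - a k) =
   \sum_(j < n) Y j * (a (j.+1 * m)%N - a (j * m)%N))%R.
Proof.
move=> m0; rewrite -(big_mkord xpredT (fun k => Y (k %/ m)%N * (a k.+1 - a k)))%R.
rewrite -(big_mkord xpredT (fun j => Y j * (a (j.+1 * m)%N - a (j * m)%N)))%R.
elim: n => [|n IH]; first by rewrite !big_geq.
rewrite big_nat_recr//= -IH.
have nm : n * m <= n.+1 * m by rewrite leq_mul2r leqnSn orbT.
rewrite (big_cat_nat (n := n * m))//=; congr +%R.
rewrite -telescope_sumr// big_distrr/=.
apply: eq_big_nat => k /andP[nk kn]; congr (Y _ * _)%R.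
by apply/eqP; rewrite eqn_leq leq_divRL// nk andbT -ltnS ltn_divLR.
Qed.

End grid_sums.

Lemma cvge0P (R : realType) (u : nat -> \bar R) : (forall n, (0 <= u n)%E) ->
  u n @[n --> \oo] --> 0%E <->
  (forall e : R, 0 < e -> \forall n \near \oo, (u n <= e%:E)%E).
Proof.
move=> u0; split=> [/fine_cvgP[ufin /cvgrPdist_le ucvg] e e0|ule].
  near=> n; have ufn : u n \is a fin_num by near: n.
  rewrite -(fineK ufn) lee_fin.
  have : `|0 - (fine \o u) n| <= e by near: n; exact: ucvg.
  by rewrite sub0r normrN/=; apply: le_trans; exact: ler_norm.
apply/fine_cvgP; split.
  have := ule 1 ltr01; apply: filterS => n un1.
  by rewrite ge0_fin_numE// (le_lt_trans un1)// ltry.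
apply/cvgrPdist_le => e e0; have := ule e e0; apply: filterS => n une.
have ufn : u n \is a fin_num by rewrite ge0_fin_numE// (le_lt_trans une)// ltry.
rewrite sub0r normrN/= ger0_norm; last exact: fine_ge0.
by rewrite -lee_fin fineK.
Unshelve. all: by end_near. Qed.

(** * Equal partitions *)

Section uniform_grid.
Context (R : realType) (T : R) (T0 : 0 < T).

Definition grid (n i : nat) : R := i%:R * T / n%:R.

Definition grid_seq (n : nat) : seq R := [seq grid n i.+1 | i <- iota 0 n].

Lemma grid_ge0 n i : 0 <= grid n i.
Proof. by rewrite divr_ge0// mulr_ge0// ltW. Qed.

Lemma gridS n i : grid n i.+1 - grid n i = T / n%:R.
Proof. by rewrite /grid -mulrBl -mulrBl -natrB// subSnn mul1r. Qed.

Lemma grid_lt n i : (0 < n)%N -> grid n i < grid n i.+1.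
Proof. by move=> n0; rewrite -subr_gt0 gridS divr_gt0// ltr0n. Qed.

Lemma grid_le_end n i : (0 < n)%N -> (i <= n)%N -> grid n i <= T.
Proof.
move=> n0 ni; rewrite ler_pdivrMr ?ltr0n// mulrC ler_wpM2l ?(ltW T0)//.
by rewrite ler_nat.
Qed.

Lemma grid_refine n m j : (0 < m)%N -> grid (n * m) (j * m) = grid n j.
Proof.
move=> m0; have [->|n0] := eqVneq n 0%N; first by rewrite /grid mul0n !invr0 !mulr0.
by rewrite /grid !natrM; field; rewrite !pnatr_eq0 n0 -lt0n m0.
Qed.

Lemma grid_coarse_le n m k : (0 < n)%N -> (0 < m)%N ->
  grid n (k %/ m) <= grid (n * m) k.
Proof.
move=> n0 m0; rewrite -(grid_refine n (k %/ m) m0) /grid.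
rewrite ler_pM2r ?invr_gt0 ?ltr0n ?muln_gt0 ?n0// ler_pM2r// ler_nat.
exact: leq_divM.
Qed.

Lemma size_grid_seq n : size (grid_seq n) = n.
Proof. by rewrite size_map size_iota. Qed.

Lemma partition_point_grid n i : (i <= n)%N -> partition_point (grid_seq n) i = grid n i.
Proof.
case: i => [_|i ni]; first by rewrite /partition_point/= /grid !mul0r.
by rewrite /partition_point/= (nth_map 0%N) ?size_iota// nth_iota.
Qed.

Lemma grid_seq_partition n : (0 < n)%N -> itv_partition 0 T (grid_seq n).
Proof.
move=> n0; split.
  apply/(pathP 0) => i; rewrite size_grid_seq => ni.
  have := grid_lt i n0; rewrite -(partition_point_grid ni).
  by rewrite -(partition_point_grid (ltnW ni)).
rewrite -nth_last size_grid_seq; apply/eqP.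
transitivity (partition_point (grid_seq n) n).
  by rewrite /partition_point; case: n n0.
by rewrite partition_point_grid// /grid mulrC mulKf// pnatr_eq0 -lt0n.
Qed.

Lemma mesh_grid_seq n e : 0 < e -> T / n%:R < e -> mesh (grid_seq n) < e.
Proof.
move=> e0 Tne; apply: bigmax_lt => // i _.
have := ltn_ord i; rewrite [X in (_ < X)%N]size_grid_seq => ni.
by rewrite !partition_point_grid ?(ltnW ni)// gridS.
Qed.

(** Lets the limit over arbitrary partitions be evaluated along the sequence of equal ones. *)
Lemma grid_seq_cvg : grid_seq n @[n --> \oo] --> mesh_to0 T.
Proof.
move=> S [e /= e0 eS].
have [N TN] : exists N : nat, T / e < N%:R.
  by exists (Num.bound (T / e)); apply: archi_boundP; rewrite divr_ge0 ?ltW.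
exists N => // n /= Nn; apply: eS.
have TeN : T / e < n%:R by rewrite (lt_le_trans TN)// ler_nat.
have n0 : (0 < n)%N by rewrite -(ltr0n R) (le_lt_trans _ TeN)// divr_ge0 ?ltW.
split; first exact: grid_seq_partition.
by apply: mesh_grid_seq => //; rewrite ltr_pdivrMr ?ltr0n// mulrC -ltr_pdivrMr.
Qed.

End uniform_grid.

(** * Sums over selected cells of an equal partition *)

Section uniform_sums.
Context d (Omega : measurableType d) (R : realType) (P : probability Omega R).
Variables (B : R -> {RV P >-> R}) (hB : is_brownian_motion B).
Variables (T : R) (T0 : 0 < T).
Variables (Phi : R -> Omega -> R) (hPhi : non_anticipating B T Phi).
Local Notation F := (brownian_filtration B).
Local Notation D := (increment B).
Local Notation g := (grid T).
Local Open Scope ereal_scope.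

(** Selection is a 0/1 factor of the weight, so full, deleted and retained sums have one shape and
    the weights remain adapted. *)
Definition masked_sum (J : pred nat) (n : nat) (w : Omega) : R :=
  (\sum_(j < n) (J j)%:R * Phi (g n j) w * D (g n j) (g n j.+1) w)%R.

Lemma adapted_mask (t : R) (b : bool) (f : Omega -> R) : adapted_fun (F t) f ->
  adapted_fun (F t) (fun w => b%:R * f w)%R.
Proof. by move=> af; exact: measurable_funM. Qed.

Lemma expectation_sqr_mask (b : bool) (f : Omega -> R) :
  'E_P[fun w => ((b%:R * f w) ^+ 2)%R] <= 'E_P[fun w => (f w ^+ 2)%R].
Proof.
case: b; first by under [X in 'E_P[X] <= _]eq_fun do rewrite mul1r.
under [X in 'E_P[X] <= _]eq_fun do rewrite mul0r expr0n/=.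
by rewrite [X in X <= _](expectation_cst P 0) expectation_sqr_ge0.
Qed.

Lemma expectation_sqr_sum_mask_le (n : nat) (t : nat -> R) (Psi : nat -> Omega -> R)
    (J : pred nat) : (0 <= t 0%N)%R ->
  (forall i, (i < n)%N -> (t i < t i.+1)%R) ->
  (forall i, (i < n)%N -> adapted_fun (F (t i)) (Psi i)) ->
  'E_P[fun w => ((\sum_(i < n) (J i)%:R * Psi i w * D (t i) (t i.+1) w) ^+ 2)%R] <=
  'E_P[fun w => ((\sum_(i < n) Psi i w * D (t i) (t i.+1) w) ^+ 2)%R].
Proof.
move=> t0 tlt aPsi.
rewrite (expectation_sqr_sum hB t0 tlt aPsi).
rewrite (expectation_sqr_sum hB (Psi := fun i w => (J i)%:R * Psi i w)%R t0 tlt).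
  apply: lee_sum => i _; apply: lee_wpmul2l; first exact: expectation_sqr_ge0.
  exact: expectation_sqr_mask.
by move=> i ni; apply: adapted_mask; exact: aPsi.
Qed.

Lemma adapted_grid n i : (0 < n)%N -> (i <= n)%N -> adapted_fun (F (g n i)) (Phi (g n i)).
Proof.
move=> n0 ni; apply/(adapted_funP (filtration_sigma_algebra B (g n i))) => A mA.
by apply: hPhi => //; rewrite grid_ge0// grid_le_end.
Qed.

Lemma measurable_grid n i : (0 < n)%N -> (i <= n)%N -> measurable_fun setT (Phi (g n i)).
Proof.
move=> n0 ni; apply: adapted_fun_measurable (adapted_grid n0 ni).
- exact: filtration_sigma_algebra.
- exact: filtration_measurable.
Qed.

Lemma measurable_masked_sum J n : (0 < n)%N -> measurable_fun setT (masked_sum J n).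
Proof.
move=> n0; apply: measurable_sum => i; apply: measurable_funM.
  by apply: measurable_funM => //; apply: measurable_grid => //; exact: ltnW.
exact: measurable_increment.
Qed.

Lemma masked_sum_fine J n m w : (0 < m)%N ->
  masked_sum J n w =
  (\sum_(k < n * m) (J (k %/ m)%N)%:R * Phi (g n (k %/ m)) w *
     D (g (n * m) k) (g (n * m) k.+1) w)%R.
Proof.
move=> m0; rewrite (@sum_coarse_increment R n m (fun k => B (g (n * m) k) w)
  (fun j => (J j)%:R * Phi (g n j) w)%R m0).
by apply: eq_bigr => j _; rewrite !grid_refine.
Qed.

Lemma masked_sumT n w : masked_sum xpredT n w =
  (\sum_(j < n) Phi (g n j) w * D (g n j) (g n j.+1) w)%R.
Proof. by apply: eq_bigr => j _; rewrite mul1r. Qed.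

Lemma masked_sum_le J n : (0 < n)%N ->
  'E_P[fun w => (masked_sum J n w ^+ 2)%R] <=
  'E_P[fun w => (masked_sum xpredT n w ^+ 2)%R].
Proof.
move=> n0; under [X in _ <= 'E_P[X]]eq_fun do rewrite masked_sumT.
apply: (expectation_sqr_sum_mask_le (Psi := fun i => Phi (g n i))) => [|i ni|i ni].
- exact: grid_ge0.
- exact: grid_lt.
- by apply: adapted_grid => //; exact: ltnW.
Qed.

(** Each term of the second-moment identity is bounded by the finite total, and an infinite second
    moment of [Phi] would make its term infinite because the increment has positive second
    moment. *)
Lemma grid_sqr_lty m i : (0 < m)%N ->
  'E_P[fun w => (masked_sum xpredT m w ^+ 2)%R] < +oo -> (i < m)%N ->
  'E_P[fun w => (Phi (g m i) w ^+ 2)%R] < +oo.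
Proof.
move=> m0 + im; under [X in 'E_P[X] < _ -> _]eq_fun do rewrite masked_sumT.
rewrite (expectation_sqr_sum hB (Psi := fun i => Phi (g m i))); first last.
- by move=> j jm; apply: adapted_grid => //; exact: ltnW.
- by move=> j _; exact: grid_lt.
- exact: grid_ge0.
have im' : (0 <= g m i < g m i.+1)%R by rewrite grid_ge0// grid_lt.
rewrite (bigD1 (Ordinal im))//= => oo.
have : 'E_P[fun w => (D (g m i) (g m i.+1) w ^+ 2)%R] *
    'E_P[fun w => (Phi (g m i) w ^+ 2)%R] < +oo.
  apply: le_lt_trans oo; rewrite leeDl// sume_ge0// => j _.
  by rewrite mule_ge0// expectation_sqr_ge0.
rewrite !ltey; apply: contra => /eqP ->.
by rewrite gt0_muley// increment_sqr_gt0.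
Qed.

(** In 16 = 2 * 8, the 2 comes from (x + y)^2 <= 2 x^2 + 2 y^2 and the 8 from [increment_sqr_le].
    The fine cells inside the selected cells have total length T times the proportion of selected
    cells, whatever m is. *)
Lemma masked_sum_sqr_le (J : pred nat) (n m : nat) (C : R) : (0 < n)%N -> (0 < m)%N ->
  (0 <= C)%R ->
  (forall i, (i < m)%N -> 'E_P[fun w => (Phi (g m i) w ^+ 2)%R] <= C%:E) ->
  'E_P[fun w => (masked_sum J n w ^+ 2)%R] <=
  2%:E * 'E_P[fun w => ((masked_sum xpredT n w - masked_sum xpredT m w) ^+ 2)%R] +
  (16 * T * C * ((\sum_(j < n) (J j)%:R) / n%:R))%:E.
Proof.
move=> n0 m0 C0 hC; set N := (n * m)%N.
have N0 : (0 < N)%N by rewrite muln_gt0 n0.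
pose t := g N; pose Jf k := J (k %/ m)%N.
have t0 : (0 <= t 0%N)%R by exact: grid_ge0.
have tlt i : (i < N)%N -> (t i < t i.+1)%R by move=> _; exact: grid_lt.
(* A cell of the n-grid holds m fine cells and a cell of the m-grid holds n of them, hence the
   crossed divisors. *)
pose fn k := Phi (g n (k %/ m)); pose fm k := Phi (g m (k %/ n)).
have kn k : (k < N)%N -> (k %/ m < n)%N by rewrite ltn_divLR.
have km k : (k < N)%N -> (k %/ n < m)%N by rewrite ltn_divLR// mulnC.
have afn k : (k < N)%N -> adapted_fun (F (t k)) (fn k).
  move=> kN; apply: (@adapted_fun_le _ _ _ _ _ (g n (k %/ m))).
    exact: grid_coarse_le.
  by apply: adapted_grid => //; exact/ltnW/kn.
have afm k : (k < N)%N -> adapted_fun (F (t k)) (fm k).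
  move=> kN; apply: (@adapted_fun_le _ _ _ _ _ (g m (k %/ n))).
    by rewrite /t /N mulnC; exact: grid_coarse_le.
  by apply: adapted_grid => //; exact/ltnW/km.
have adiff k : (k < N)%N -> adapted_fun (F (t k)) (fun w => fn k w - fm k w)%R.
  by move=> kN; apply: measurable_funB; [exact: afn|exact: afm].
pose A w := (\sum_(k < N) (Jf k)%:R * (fn k w - fm k w) * D (t k) (t k.+1) w)%R.
pose Q w := (\sum_(k < N) (Jf k)%:R * fm k w * D (t k) (t k.+1) w)%R.
have mm k (f : Omega -> R) : adapted_fun (F (t k)) f -> measurable_fun setT f.
  apply: adapted_fun_measurable.
  - exact: filtration_sigma_algebra.
  - exact: filtration_measurable.
have mA : measurable_fun setT A.
  apply: measurable_sum => k; apply: measurable_funM; last exact: measurable_increment.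
  by apply: measurable_funM => //; apply: (mm k); exact: adiff.
have mQ : measurable_fun setT Q.
  apply: measurable_sum => k; apply: measurable_funM; last exact: measurable_increment.
  by apply: measurable_funM => //; apply: (mm k); exact: afm.
have -> : 'E_P[fun w => (masked_sum J n w ^+ 2)%R] = 'E_P[fun w => ((A w + Q w) ^+ 2)%R].
  congr expectation; apply/funext => w; congr (_ ^+ 2)%R.
  rewrite (masked_sum_fine _ _ _ m0) -big_split/=.
  by apply: eq_bigr => k _; rewrite -mulrDl -mulrDr subrK.
apply: (le_trans (expectation_sqrD_le P mA mQ)); apply: leeD.
  apply: lee_wpmul2l => //.
  rewrite [X in _ <= X](_ : _ =
    'E_P[fun w => ((\sum_(k < N) (fn k w - fm k w) * D (t k) (t k.+1) w) ^+ 2)%R]).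
    exact: (expectation_sqr_sum_mask_le (Psi := fun k w => fn k w - fm k w)%R).
  congr expectation; apply/funext => w; congr (_ ^+ 2)%R.
  rewrite (masked_sum_fine _ _ _ m0) (masked_sum_fine _ _ _ n0) (mulnC m n) -/N -sumrB.
  by apply: eq_bigr => k _; rewrite !mul1r mulrBl.
rewrite (expectation_sqr_sum hB (Psi := fun k w => (Jf k)%:R * fm k w)%R t0 tlt); last first.
  by move=> k kN; apply: adapted_mask; exact: afm.
(* The factor [k.+1%:R - k%:R] is 1, written as an increment so that [sum_coarse_increment] can
   collect the m fine cells of each coarse cell. *)
apply: (@le_trans _ _ (2%:E *
    \sum_(k < N) (8 * (T / N%:R) * C * ((Jf k)%:R * (k.+1%:R - k%:R)))%:E)).
  apply: lee_wpmul2l => //; apply: lee_sum => k _.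
  apply: (@le_trans _ _ ((8 * (T / N%:R))%:E * (C * (Jf k)%:R)%:E)); last first.
    rewrite -EFinM lee_fin -natrB// subSnn.
    by rewrite [leRHS](_ : _ = 8 * (T / N%:R) * (C * (Jf k)%:R))%R//; ring.
  apply: lee_pmul; try exact: expectation_sqr_ge0.
    rewrite -(gridS T N k); apply: (increment_sqr_le hB).
    by rewrite grid_ge0// grid_lt.
  case: (Jf k); last first.
    rewrite mulr0; under [X in 'E_P[X] <= _]eq_fun do rewrite mul0r expr0n/=.
    by rewrite [X in X <= _](expectation_cst P 0).
  rewrite mulr1; apply: (le_trans (expectation_sqr_mask true _)).
  exact/hC/km.
rewrite sumEFin -EFinM lee_fin -mulr_sumr.
rewrite (@sum_coarse_increment R n m (fun k => k%:R) (fun j => (J j)%:R) m0).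
under eq_bigr do rewrite -natrB ?leq_mul2r ?leqnSn ?orbT// -mulnBl subSnn mul1n.
rewrite -mulr_suml le_eqVlt; apply/orP; left; apply/eqP.
by rewrite /N natrM; field; rewrite !pnatr_eq0 -!lt0n n0 m0.
Qed.

End uniform_sums.

(** * Mean-square convergence of the sums with deleted terms *)

Theorem theorem5 (d : measure_display) (Omega : measurableType d)
    (R : realType) (P : probability Omega R)
    (B : R -> {RV P >-> R}) (hB : is_brownian_motion B)
    (T : R) (hT : 0 < T)
    (Phi : R -> Omega -> R) (hPhi : non_anticipating B T Phi)
    (I : Omega -> R) (hI : is_ito_integral B Phi T I)
    (K : nat -> nat) (hK : forall n, (1 < n)%N -> (0 < K n < n)%N)
    (hKlim : (K n)%:R / n%:R @[n --> \oo] --> (0 : R))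
    (JK : forall n, {set 'I_n})
    (hJK : forall n, (1 < n)%N -> #|JK n| = K n) :
  is_lim_ms P \oo
    (fun n w => \sum_(j < n | j \notin JK n)
       Phi (j%:R * T / n%:R) w *
         (B (j.+1%:R * T / n%:R) w - B (j%:R * T / n%:R) w))
    I.
Proof.
have [IL2 UL2 Ucvg] := hI.
pose U := masked_sum B T Phi xpredT.
have UE n : ito_sum B Phi (grid_seq T n) = U n.
  apply/funext => w; rewrite /U masked_sumT /ito_sum size_grid_seq.
  apply: eq_bigr => i _.
  by rewrite !partition_point_grid// ltnW.
have {}UL2 : \forall n \near \oo, U n \in Lfun P 2%:E.
  have h : \forall n \near \oo, ito_sum B Phi (grid_seq T n) \in Lfun P 2%:E.
    exact: grid_seq_cvg hT _ UL2.
  by apply: filterS h => n; rewrite UE.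
have {}Ucvg : 'E_P[fun w => ((U n w - I w) ^+ 2)%R]%E @[n --> \oo] --> 0%E.
  have := cvg_comp _ _ (grid_seq_cvg hT) Ucvg.
  rewrite (_ : _ \o _ = fun n => 'E_P[fun w => ((U n w - I w) ^+ 2)%R]%E)//.
  by apply/funext => n /=; rewrite UE.
have Ule := (cvge0P (fun n => expectation_sqr_ge0 P _)).1 Ucvg.
have [mI _] := (Lfun2P P I).1 IL2.
(* The sets of ordinals become predicates on natural numbers, the type of mask used by
   [masked_sum]. *)
pose J n : pred nat := fun j => j \in [seq val i | i in JK n].
have JE n (j : 'I_n) : J n j = (j \in JK n).
  by rewrite /J mem_map ?mem_enum//; exact: val_inj.
pose V n := masked_sum B T Phi (J n) n.
pose X n := masked_sum B T Phi (predC (J n)) n.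
have XE n w : X n w = U n w - V n w.
  rewrite /X /U /V -sumrB; apply: eq_bigr => j _ /=.
  by case: (J n j); rewrite /= ?mul1r ?mul0r ?subr0 ?subrr.
have sumJ n : (1 < n)%N -> \sum_(j < n) (J n j)%:R = (K n)%:R :> R.
  move=> n1; rewrite -hJK// -sum1_card natr_sum [RHS]big_mkcond/=.
  by apply: eq_bigr => j _; rewrite JE; case: ifP.
have mU n : (0 < n)%N -> measurable_fun setT (U n).
  by move=> n0; exact: (measurable_masked_sum hT hPhi).
have mV n : (0 < n)%N -> measurable_fun setT (V n).
  by move=> n0; exact: (measurable_masked_sum hT hPhi).
have Vle (e : R) : 0 < e ->
    \forall n \near \oo, ('E_P[fun w => (V n w ^+ 2)%R] <= e%:E)%E.
  (* Through I, two errors e / 16 give E (U_n - U_m)^2 <= e / 4, which enters doubled. The other e /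
     2 is left for the term in K(n) / n. The index m is fixed before n, so [C] depends on e but not
     on n. *)
  move=> e0; have e16 : 0 < e / 16 by rewrite divr_gt0.
  have [m [m0 [/Lfun2P[_ Umoo] Um]]] :=
    filter_ex (filterI (nbhs_infty_gt 0) (filterI UL2 (Ule _ e16))).
  pose C := \sum_(i < m) fine 'E_P[fun w => (Phi (grid T m i) w ^+ 2)%R]%E.
  have Cfin i : (i < m)%N -> 'E_P[fun w => (Phi (grid T m i) w ^+ 2)%R]%E \is a fin_num.
    move=> im; rewrite ge0_fin_numE ?expectation_sqr_ge0//.
    exact: (grid_sqr_lty hB hT hPhi m0 Umoo).
  have C0 : 0 <= C.
    by apply: sumr_ge0 => i _; apply: fine_ge0; exact: expectation_sqr_ge0.
  have hC i : (i < m)%N -> ('E_P[fun w => (Phi (grid T m i) w ^+ 2)%R] <= C%:E)%E.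
    move=> im; rewrite -(fineK (Cfin _ im)) lee_fin /C (bigD1 (Ordinal im))//= lerDl.
    by apply: sumr_ge0 => j _; apply: fine_ge0; exact: expectation_sqr_ge0.
  (* The added 1 keeps the divisor positive when [C] is 0. *)
  pose M := 16 * T * C + 1.
  have TC0 : 0 <= 16 * T * C by rewrite mulr_ge0// mulr_ge0// ltW.
  have M0 : 0 < M by rewrite ltr_wpDl.
  near=> n.
  have n1 : (1 < n)%N by near: n; exact: nbhs_infty_gt.
  have n0 := ltnW n1.
  have Un : ('E_P[fun w => ((U n w - I w) ^+ 2)%R] <= (e / 16)%:E)%E by near: n; exact: Ule.
  have Kn : (K n)%:R / n%:R <= e / 2 / M.
    have : `|0 - (K n)%:R / n%:R| <= e / 2 / M.
      near: n; have /cvgrPdist_le := hKlim; apply.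
      by rewrite !divr_gt0.
    by rewrite sub0r normrN; apply: le_trans; exact: ler_norm.
  have := masked_sum_sqr_le hB hT hPhi (J n) n0 m0 C0 hC.
  rewrite sumJ// => Vn; apply: (le_trans Vn).
  have UU : ('E_P[fun w => ((U n w - U m w) ^+ 2)%R] <= (e / 4)%:E)%E.
    rewrite (_ : (fun w => _) = fun w => ((U n w - I w) + (I w - U m w)) ^+ 2); last first.
      by apply/funext => w; rewrite addrA subrK.
    have mUI : measurable_fun setT (fun w => U n w - I w).
      by apply: measurable_funB => //; exact: mU.
    have mIU : measurable_fun setT (fun w => I w - U m w).
      by apply: measurable_funB => //; exact: mU.
    apply: (le_trans (expectation_sqrD_le P mUI mIU)).
    rewrite [leRHS](_ : _ = 2%:E * (e / 16)%:E + 2%:E * (e / 16)%:E)%E; last first.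
      by rewrite -!EFinM -EFinD; congr EFin; field.
    apply: leeD; apply: lee_wpmul2l => //.
    by under [X in ('E_P[X] <= _)%E]eq_fun do rewrite -sqrrN opprB.
  apply: (@le_trans _ _ (2%:E * (e / 4)%:E + (e / 2)%:E)%E); last first.
    by rewrite -EFinM -EFinD lee_fin; lra.
  apply: leeD; first exact: lee_wpmul2l.
  rewrite lee_fin; apply: (le_trans (ler_wpM2l TC0 Kn)).
  rewrite mulrA ler_pdivrMr// mulrC ler_wpM2l ?divr_ge0 ?(ltW e0)//.
  by rewrite lerDl.
rewrite (_ : (fun n w => _) = X); last first.
  apply/funext => n; apply/funext => w; rewrite big_mkcond/=.
  by apply: eq_bigr => j _; rewrite /= JE; case: ifP => _; rewrite ?mul1r ?mul0r.
split => //.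
  near=> n; have n0 : (0 < n)%N by near: n; exact: nbhs_infty_gt.
  have /Lfun2P[_ Unoo] : U n \in Lfun P 2%:E by near: n.
  apply/Lfun2P; split; first exact: (measurable_masked_sum hT hPhi).
  exact: le_lt_trans (masked_sum_le hB hT hPhi _ n0) Unoo.
apply/cvge0P => [n|e e0]; first exact: expectation_sqr_ge0.
(* The error is (U_n - I) - V_n, and each of the two parts enters doubled. *)
have e4 : 0 < e / 4 by rewrite divr_gt0.
near=> n.
have n0 : (0 < n)%N by near: n; exact: nbhs_infty_gt.
have Un : ('E_P[fun w => ((U n w - I w) ^+ 2)%R] <= (e / 4)%:E)%E by near: n; exact: Ule.
have Vn : ('E_P[fun w => (V n w ^+ 2)%R] <= (e / 4)%:E)%E by near: n; exact: Vle.
rewrite (_ : (fun w => _) = fun w => ((U n w - I w) + (- V n w)) ^+ 2); last first.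
  by apply/funext => w; rewrite XE addrAC.
have mUI : measurable_fun setT (fun w => U n w - I w).
  by apply: measurable_funB => //; exact: mU.
have mNV : measurable_fun setT (fun w => - V n w).
  by apply: measurableT_comp => //; exact: mV.
apply: (le_trans (expectation_sqrD_le P mUI mNV)).
rewrite [leRHS](_ : _ = 2%:E * (e / 4)%:E + 2%:E * (e / 4)%:E)%E; last first.
  by rewrite -!EFinM -EFinD; congr EFin; field.
apply: leeD; apply: lee_wpmul2l => //.
by under [X in ('E_P[X] <= _)%E]eq_fun do rewrite sqrrN.
Unshelve. all: by end_near. Qed.
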